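(* Let $(\mathfrak{B},\mathbf{B})$ be a maximal Banach ideal such that $\mathfrak{B}\subseteq\mathfrak{L}_\infty$. Then $(\mathfrak{B}\circ\mathfrak{L}_2,\mathbf{B}\circ\mathbf{L}_2)$ cannot be a $1$-Banach ideal.
   Context: All Banach spaces are over $\mathbb{K}\in\{\mathbb{R},\mathbb{C}\}$; ''operator'' means bounded linear operator and $\mathfrak{L}(X,Y)$ is the space of all operators from $X$ to $Y$. Quasi-Banach (operator) ideals $(\mathfrak{A},\mathbf{A})$ are meant in the sense of Pietsch. $(\mathfrak{A},\mathbf{A})$ is a 1-Banach ideal (Banach ideal) if the given ideal quasi-norm $\mathbf{A}$ itself is a norm. $\mathfrak{A}\subseteq\mathfrak{B}$ means $\mathfrak{A}(X,Y)\subseteq\mathfrak{B}(X,Y)$ for all Banach spaces $X,Y$. Product ideal: $T\in(\mathfrak{A}\circ\mathfrak{B})(X,Y)$ iff $T=RS$ with $S\in\mathfrak{B}(X,Z)$, $R\in\mathfrak{A}(Z,Y)$ for some Banach space $Z$; $(\mathbf{A}\circ\mathbf{B})(T)=\inf\mathbf{A}(R)\,\mathbf{B}(S)$ over all such factorizations. $(\mathfrak{L}_2,\mathbf{L}_2)$: the operators that factor through a Hilbert space, $\mathbf{L}_2(T)=\inf\{\|R\|\|S\|: T=RS \text{ through a Hilbert space}\}$. Maximal: the maximal hull $(\mathfrak{A}^{\max},\mathbf{A}^{\max})$ consists of all $T\in\mathfrak{L}(X,Y)$ such that $RTS\in\mathfrak{A}(X_0,Y_0)$ for all Banach spaces $X_0,Y_0$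 and all approximable operators (norm limits of finite rank operators) $S:X_0\to X$, $R:Y\to Y_0$, with $\mathbf{A}^{\max}(T)=\sup\{\mathbf{A}(RTS):\|R\|,\|S\|\le1\}$. $(\mathfrak{A},\mathbf{A})$ is maximal if it coincides isometrically with its maximal hull. Adjoint ideal: $\mathfrak{A}^{*}(X,Y)$ is the set of all $T\in\mathfrak{L}(X,Y)$ with $\mathbf{A}^{*}(T):=\sup\{|\mathrm{tr}(TJ_E^XSQ_K^Y)|\}<\infty$, the supremum being over all finite-dimensional subspaces $E\subseteq X$, all closed finite-codimensional subspaces $K\subseteq Y$, and all $S\in\mathfrak{L}(Y/K,E)$ with $\mathbf{A}(S)\le1$; here $J_E^X:E\to X$ is the inclusion and $Q_K^Y:Y\to Y/K$ the quotient map. $(\mathfrak{P}_1,\mathbf{P}_1)$ is the ideal of absolutely 1-summing operators and $(\mathfrak{L}_\infty,\mathbf{L}_\infty):=(\mathfrak{P}_1^{*},\mathbf{P}_1^{*})$ its adjoint. *)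

(* Defs.v *)
From HB Require Import structures.
From mathcomp Require Import all_boot all_order all_algebra.
From mathcomp Require Import all_classical all_reals all_analysis.
From mathcomp Require Import complex lra generic_quotient ring_quotient.

Set Implicit Arguments.
Unset Strict Implicit.
Unset Printing Implicit Defensive.

Import Order.TTheory GRing.Theory Num.Theory.
Import numFieldNormedType.Exports.

Local Open Scope classical_set_scope.
Local Open Scope ring_scope.

Variant scalars := RealScalars | ComplexScalars.

Definition scalar_field (R : realType) (s : scalars) : numFieldType :=
  match s with RealScalars => R | ComplexScalars => R[i] end.

(* Norms of normed modules over [K] take their values in [K]; [toR] reads such
   a (nonnegative, hence real) value as an element of [R]. *)
Definition toR {R : realType} {s : scalars} : scalar_field R s -> R :=
  match s return scalar_field R s -> R with
  | RealScalars => fun x => x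
  | ComplexScalars => @complex.Re R
  end.

Definition ofR {R : realType} {s : scalars} : R -> scalar_field R s :=
  match s return R -> scalar_field R s with
  | RealScalars => fun x => x
  | ComplexScalars => fun x => x%:C%C
  end.

Definition scalar_conj {R : realType} {s : scalars} :
    scalar_field R s -> scalar_field R s :=
  match s return scalar_field R s -> scalar_field R s with
  | RealScalars => fun x => x
  | ComplexScalars => @complex.conjc R
  end.

Section scalar_theory.
Variables (R : realType) (s : scalars).
Local Notation K := (scalar_field R s).

Lemma ofRK : cancel (@ofR R s) toR. Proof. by case: s. Qed.

Lemma toRK (x : K) : 0 <= x -> ofR (toR x) = x.
Proof.
case: s x => //= x; rewrite lecE => /andP[/eqP/= x0 _].
by case: x x0 => a b /= ->.
Qed.

Lemma ler_ofR (x y : R) : (ofR x <= ofR y :> K) = (x <= y).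
Proof. by case: s => //=; exact: lecR. Qed.

Lemma ltr_ofR (x y : R) : (ofR x < ofR y :> K) = (x < y).
Proof. by rewrite !lt_neqAle ler_ofR (can_eq ofRK). Qed.

Lemma ofRD (x y : R) : ofR (x + y) = ofR x + ofR y :> K.
Proof. by case: s => //=; exact: raddfD. Qed.

Lemma ofRM (x y : R) : ofR (x * y) = ofR x * ofR y :> K.
Proof. by case: s => //=; exact: rmorphM. Qed.

Lemma ofR0 : ofR 0 = 0 :> K. Proof. by case: s. Qed.
Lemma ofR1 : ofR 1 = 1 :> K. Proof. by case: s. Qed.

End scalar_theory.

Definition nrm {R : realType} {s : scalars}
  {V : normedModType (scalar_field R s)} (x : V) : R := toR `|x|.

Definition fast_cauchy {R : realType} {s : scalars}
    {V : normedModType (scalar_field R s)} (u : nat -> V) :=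
  forall n, nrm (u n.+1 - u n) < 2^-1 ^+ n.

Section nrm_theory.
Variables (R : realType) (s : scalars).
Local Notation K := (scalar_field R s).
Implicit Types V : normedModType K.

Lemma nrmE V (x : V) : ofR (nrm x) = `|x|.
Proof. by rewrite toRK. Qed.

Lemma nrm_ge0 V (x : V) : 0 <= nrm x.
Proof. by rewrite -(ler_ofR s) nrmE ofR0. Qed.

Lemma nrm0 V : nrm (0 : V) = 0.
Proof. by rewrite /nrm normr0 -(ofR0 R s) ofRK. Qed.

Lemma nrm0_eq0 V (x : V) : nrm x = 0 -> x = 0.
Proof. by move=> x0; apply/normr0_eq0; rewrite -nrmE x0 ofR0. Qed.

Lemma ler_nrmD V (x y : V) : nrm (x + y) <= nrm x + nrm y.
Proof. by rewrite -(ler_ofR s) ofRD !nrmE ler_normD. Qed.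

Lemma nrmN V (x : V) : nrm (- x) = nrm x.
Proof. by rewrite /nrm normrN. Qed.

Lemma nrmB V (x y : V) : nrm (x - y) = nrm (y - x).
Proof. by rewrite /nrm distrC. Qed.

Lemma nrmZ V (k : K) (x : V) : nrm (k *: x) = toR `|k| * nrm x.
Proof.
by apply: (can_inj (@ofRK R s)); rewrite ofRM !nrmE normrZ.
Qed.

Lemma cvg_nrmP V T (F : set_system T) (FF : Filter F) (f : T -> V) (l : V) :
  f @ F --> l <-> forall e : R, 0 < e -> \forall t \near F, nrm (l - f t) < e.
Proof.
rewrite cvgrPdist_lt; split => H e e0.
- have := H (ofR e); rewrite -(ofR0 R s) ltr_ofR => /(_ e0).
  by apply: filterS => t; rewrite -nrmE ltr_ofR.
- have e0' : ofR (toR e) = e by rewrite toRK// ltW.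
  have := H (toR e); rewrite -(ltr_ofR s) e0' ofR0 => /(_ e0).
  by apply: filterS => t; rewrite -(ltr_ofR s) nrmE e0'.
Qed.

Let half_lt (e : R) : 0 < e -> \forall n \near \oo, 2^-1 ^+ n < e.
Proof.
move=> e0; have := @cvg_expr R (2^-1).
rewrite ger0_norm ?invr_ge0// invf_lt1// ltr1n => /(_ isT).
move=> /cvgrPdist_lt/(_ e e0); apply: filterS => n.
by rewrite sub0r normrN ger0_norm// exprn_ge0// invr_ge0.
Qed.

Let fast_tail V (u : nat -> V) : fast_cauchy u ->
  forall n p, nrm (u (n + p)%N - u n) <= 2 * 2^-1 ^+ n - 2 * 2^-1 ^+ (n + p).
Proof.
move=> fu n; elim => [|p IH]; first by rewrite addn0 !subrr nrm0.
rewrite -(subrK (u (n + p)%N) (u _)) -addrA addnS.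
apply: le_trans (ler_nrmD _ _) _.
apply: le_trans (lerD (ltW (fu _)) IH) _.
by rewrite [in leRHS]exprS mulrA mulfV// mul1r; lra.
Qed.

Lemma complete_fast V :
  (forall u : nat -> V, fast_cauchy u -> exists l : V, u @ \oo --> l) ->
  forall F : set_system V, ProperFilter F -> cauchy F -> cvg F.
Proof.
move=> H F FF /cauchyP cF.
have /choice[c cP] : forall n, exists x, F [set y | nrm (x - y) < 2^-1 ^+ n.+2].
  move=> n; have [|x Fx] := cF (ofR (2^-1 ^+ n.+2)).
    by rewrite -(ofR0 R s) ltr_ofR exprn_gt0// invr_gt0.
  exists x; apply: filterS Fx => y.
  by rewrite -ball_normE/= -nrmE ltr_ofR.
have fc : fast_cauchy c.
  move=> n; have [y [/= y1 y2]] := filter_ex (filterI (cP n) (cP n.+1)).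
  rewrite nrmB -(subrK y (c n)) -addrA.
  apply: le_lt_trans (ler_nrmD _ _) _; rewrite (nrmB y).
  apply: lt_le_trans (ltrD y1 y2) _.
  have h0 : 0 <= 2^-1 ^+ n :> R by rewrite exprn_ge0// invr_ge0.
  by rewrite !exprS; lra.
have [l cl] := H c fc.
apply/cvg_ex; exists l; apply/(@cvg_nrmP V V F _ id l) => e e0.
have e20 : 0 < e / 2 by rewrite divr_gt0.
have /cvg_nrmP/(_ _ e20) c1 := cl.
have [n [/= n1 n2]] := filter_ex (filterI c1 (half_lt e20)).
apply: filterS (cP n) => y /= ny.
rewrite -(subrK (c n) l) -addrA.
apply: le_lt_trans (ler_nrmD _ _) _.
rewrite [ltRHS](splitr e) ltrD//; apply: lt_trans ny _.
apply: le_lt_trans n2; rewrite !exprS.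
have h0 : 0 <= 2^-1 ^+ n :> R by rewrite exprn_ge0// invr_ge0.
by lra.
Qed.

Lemma fast_cvg (V : completeNormedModType K) (u : nat -> V) :
  fast_cauchy u -> exists l : V, u @ \oo --> l.
Proof.
move=> fu; apply/cvg_ex/cauchy_cvgP/cauchyP => e e0.
have er : 0 < toR e by rewrite -(ltr_ofR s) ofR0 toRK// ltW.
have e20 : 0 < toR e / 2 by rewrite divr_gt0.
have [n nP] := filter_ex (half_lt e20).
exists (u n); exists n => // m /= nm; rewrite -ball_normE/= -nrmE.
rewrite -[e]toRK ?ltW// ltr_ofR nrmB -(subnKC nm).
apply: le_lt_trans (fast_tail fu _ _) _.
have h0 : 0 <= 2^-1 ^+ (n + (m - n)) :> R by rewrite exprn_ge0// invr_ge0.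
by lra.
Qed.

End nrm_theory.

(* An alias of [scalar_field R s], complete for both kinds of scalars. *)
Definition scalar_line (R : realType) (s : scalars) : Type :=
  (scalar_field R s)^o.

HB.instance Definition _ R s :=
  NormedModule.copy (scalar_line R s) (scalar_field R s)^o.

Import Normc.
Section scalar_line_complete.
Variable R : realType.

Let abs_fast_cvg (v : nat -> R) :
  (forall n, `|v n.+1 - v n| < 2^-1 ^+ n) ->
  exists a, forall e, 0 < e -> \forall n \near \oo, `|a - v n| < e.
Proof.
move=> fv.
have [l /cvgrPdist_lt vl] :=
  @fast_cvg R RealScalars (R : completeNormedModType R) v fv.
by exists l.
Qed.

Let normcE (x : R[i]) : `|x| = (normc x)%:C%C. Proof. by []. Qed.

Let normc_Re (x : R[i]) : `|complex.Re x| <= normc x.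
Proof. by rewrite -lecR -normcE normc_ge_Re. Qed.

Let normc_Im (x : R[i]) : `|complex.Im x| <= normc x.
Proof.
case: x => a b /=; rewrite -sqrtr_sqr ler_sqrt ?addr_ge0 ?sqr_ge0//.
by rewrite lerDr sqr_ge0.
Qed.

Let normc_le (x : R[i]) : normc x <= `|complex.Re x| + `|complex.Im x|.
Proof.
case: x => a b /=.
rewrite -[leRHS]ger0_norm ?addr_ge0// -sqrtr_sqr ler_sqrt ?sqr_ge0//.
rewrite sqrrD !real_normK ?num_real// -addrA lerD2l lerDr.
by rewrite mulrn_wge0// mulr_ge0.
Qed.

Let fast_scalar_cvg (s : scalars) (u : nat -> scalar_line R s) :
  fast_cauchy u -> exists l : scalar_line R s, u @ \oo --> l.
Proof.
case: s u => u fu.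
  by have [l] := abs_fast_cvg fu; exists l; apply/cvg_nrmP.
have /abs_fast_cvg[a aP] n :
    `|complex.Re (u n.+1 : R[i]) - complex.Re (u n : R[i])| < 2^-1 ^+ n.
  apply: le_lt_trans (fu n); rewrite -raddfB/=.
  exact: (normc_Re (u n.+1 - u n : R[i])).
have /abs_fast_cvg[b bP] n :
    `|complex.Im (u n.+1 : R[i]) - complex.Im (u n : R[i])| < 2^-1 ^+ n.
  apply: le_lt_trans (fu n); rewrite -raddfB/=.
  exact: (normc_Im (u n.+1 - u n : R[i])).
exists (Complex a b); apply/cvg_nrmP => e e0.
have e20 : 0 < e / 2 by rewrite divr_gt0.
near=> n.
apply: (@le_lt_trans _ _ (normc (Complex a b - u n : R[i]))) => //.
apply: le_lt_trans (normc_le _) _; rewrite !raddfB/=.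
rewrite [ltRHS](splitr e) ltrD//; near: n; [exact: aP|exact: bP].
Unshelve. all: by end_near. Qed.

Lemma scalar_line_cvg (s : scalars) (F : set_system (scalar_line R s)) :
  ProperFilter F -> cauchy F -> cvg F.
Proof. by apply: complete_fast; exact: fast_scalar_cvg. Qed.

End scalar_line_complete.

HB.instance Definition _ R s :=
  Uniform_isComplete.Build (scalar_line R s) (@scalar_line_cvg R s).

Record closed_subspace (R : realType) (s : scalars)
    (X : normedModType (scalar_field R s)) := ClosedSubspace {
  subspace_set : set X;
  subspace0 : subspace_set 0;
  subspaceD : forall x y,
    subspace_set x -> subspace_set y -> subspace_set (x + y);
  subspaceZ : forall k x, subspace_set x -> subspace_set (k *: x);
  subspace_closed : closed subspace_set
}.

Section subspace_pred.
Variables (R : realType) (s : scalars).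
Variables (X : normedModType (scalar_field R s)) (E : closed_subspace X).

Definition subspace_pred : {pred X} := fun x => `[< subspace_set E x >].

Lemma subspace_predP x : reflect (subspace_set E x) (x \in subspace_pred).
Proof. exact: asboolP. Qed.

Let subspace_pred_closed : subsemimod_closed subspace_pred.
Proof.
split; first split; first by apply/subspace_predP/subspace0.
  move=> x y /subspace_predP Ex /subspace_predP Ey.
  exact/subspace_predP/subspaceD.
by move=> k x /subspace_predP Ex; apply/subspace_predP/subspaceZ.
Qed.

HB.instance Definition _ :=
  GRing.isSubmodClosed.Build (scalar_field R s) X subspace_pred
    subspace_pred_closed.

End subspace_pred.

Section subspace.
Variables (R : realType) (s : scalars).
Local Notation K := (scalar_field R s).
Variables (X : completeNormedModType K) (E : closed_subspace X).

Definition subspace_of : Type := {x : X | x \in subspace_pred E}.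
HB.instance Definition _ := SubChoice.on subspace_of.
HB.instance Definition _ := [SubChoice_isSubLmodule of subspace_of by <:].

Let nrms (x : subspace_of) : K := `|val x|.
Let nrmsD x y : nrms (x + y) <= nrms x + nrms y.
Proof. by rewrite /nrms raddfD ler_normD. Qed.
Let nrmsZ (k : K) x : nrms (k *: x) = `|k| * nrms x.
Proof. by rewrite /nrms linearZ normrZ. Qed.
Let nrms0 x : nrms x = 0 -> x = 0.
Proof. by move=> /normr0_eq0 x0; apply: val_inj; rewrite x0 raddf0. Qed.

HB.instance Definition _ :=
  @Lmodule_isNormed.Build K subspace_of nrms nrmsD nrmsZ nrms0.

Let nrm_val (x : subspace_of) : nrm (val x) = nrm x. Proof. by []. Qed.

Let subspace_cvg (F : set_system subspace_of) :
  ProperFilter F -> cauchy F -> cvg F.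
Proof.
apply: complete_fast => u fu.
have fv : fast_cauchy (val \o u).
  by move=> n; apply: le_lt_trans (fu n); rewrite -nrm_val raddfB.
have [l vl] := fast_cvg fv.
have El : l \in subspace_pred E.
  apply/subspace_predP; apply: (closed_cvg _ (@subspace_closed _ _ _ E) _ _ vl).
  by apply: nearW => n; apply/subspace_predP; exact: valP.
exists (Sub l El); apply/cvg_nrmP => e e0.
have /cvg_nrmP/(_ e e0) := vl; apply: filterS => n.
by rewrite -nrm_val raddfB.
Qed.

HB.instance Definition _ := Uniform_isComplete.Build subspace_of subspace_cvg.

End subspace.

Section quotient.
Variables (R : realType) (s : scalars).
Local Notation K := (scalar_field R s).
Variables (X : completeNormedModType K) (E : closed_subspace X).
Local Open Scope quotient_scope.

Definition quotient_by : Type := Quotient.quot (subspace_pred E).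
HB.instance Definition _ := EqQuotient.on quotient_by.
HB.instance Definition _ := GRing.Zmodule.on quotient_by.

Definition quotient_pi (x : X) : quotient_by :=
  \pi_(Quotient.quot (subspace_pred E)) x.

Let pi_eq x y : (quotient_pi x = quotient_pi y) <-> x - y \in subspace_pred E.
Proof.
rewrite (Quotient.idealrBE (subspace_pred E)); split => [xy|/eqP//].
by apply/eqP; exact: xy.
Qed.

Lemma quotient_piD x y : quotient_pi (x + y) = quotient_pi x + quotient_pi y.
Proof. exact: raddfD. Qed.
Let piN x : quotient_pi (- x) = - quotient_pi x.
Proof. exact: raddfN. Qed.
Let pi_repr q : quotient_pi (repr q) = q.
Proof. exact: reprK. Qed.
Let piP q : exists x, quotient_pi x = q.
Proof. by exists (repr q). Qed.

Let pi0 : quotient_pi 0 = 0.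
Proof. exact: raddf0. Qed.

Definition quotient_scale (k : K) (q : quotient_by) : quotient_by :=
  quotient_pi (k *: repr q).

Let piZ k x : quotient_pi (k *: x) = quotient_scale k (quotient_pi x).
Proof.
by apply/pi_eq; rewrite -scalerBr rpredZ//; apply/pi_eq; rewrite pi_repr.
Qed.

Let scaleA a b q :
  quotient_scale a (quotient_scale b q) = quotient_scale (a * b) q.
Proof. by have [x <-] := piP q; rewrite -!piZ scalerA. Qed.
Let scale1 q : quotient_scale 1 q = q.
Proof. by have [x <-] := piP q; rewrite -!piZ scale1r. Qed.
Let scaleDr : right_distributive quotient_scale +%R.
Proof.
move=> a q r; have [x <-] := piP q; have [y <-] := piP r.
by rewrite -quotient_piD -!piZ -quotient_piD scalerDr.
Qed.
Let scaleDl q : {morph quotient_scale^~ q : a b / a + b}.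
Proof.
by move=> a b; have [x <-] := piP q; rewrite -!piZ -quotient_piD scalerDl.
Qed.

HB.instance Definition _ := GRing.Zmodule_isLmodule.Build K quotient_by
  scaleA scale1 scaleDr scaleDl.

Lemma quotient_piZ k x : quotient_pi (k *: x) = k *: quotient_pi x.
Proof. exact: piZ. Qed.

Definition quotient_norm (q : quotient_by) : R :=
  inf [set nrm x | x in [set x | quotient_pi x = q]].

Let norm_set_inf q : has_inf [set nrm x | x in [set x | quotient_pi x = q]].
Proof.
split; first by have [x qx] := piP q; exists (nrm x); exists x.
by exists 0 => _ [x _ <-]; exact: nrm_ge0.
Qed.

Lemma quotient_norm_pi x : quotient_norm (quotient_pi x) <= nrm x.
Proof.
by apply: ge_inf; [have [] := norm_set_inf (quotient_pi x)|exists x].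
Qed.

Let norm_lt q (e : R) : quotient_norm q < e ->
  exists2 x, quotient_pi x = q & nrm x < e.
Proof.
move=> qe; have [_ [x qx <-] xe] := inf_lt (norm_set_inf q).1 qe.
by exists x.
Qed.

Let norm_ge0 q : 0 <= quotient_norm q.
Proof.
apply: lb_le_inf; first by have [] := norm_set_inf q.
by move=> _ [x _ <-]; exact: nrm_ge0.
Qed.

Let normD q r : quotient_norm (q + r) <= quotient_norm q + quotient_norm r.
Proof.
apply/ler_addgt0Pr => e e0.
have e20 : 0 < e / 2 by rewrite divr_gt0.
have [x <- xe] : exists2 x, quotient_pi x = q & nrm x < quotient_norm q + e / 2.
  by apply: norm_lt; rewrite ltrDl.
have [y <- ye] : exists2 y, quotient_pi y = r & nrm y < quotient_norm r + e / 2.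
  by apply: norm_lt; rewrite ltrDl.
rewrite -quotient_piD; have xy := quotient_norm_pi (x + y).
have xyD := ler_nrmD x y.
by move: xe ye xy xyD; lra.
Qed.

Let normZ_le k q : quotient_norm (k *: q) <= toR `|k| * quotient_norm q.
Proof.
have [->|k0] := eqVneq k 0.
  rewrite scale0r normr0 -[X in toR X](ofR0 R s) ofRK mul0r.
  by rewrite -[leRHS](nrm0 X) -pi0 quotient_norm_pi.
have k0' : 0 < toR `|k|.
  by rewrite -(ltr_ofR s) toRK// ofR0 normr_gt0.
rewrite -ler_pdivrMl//; apply: lb_le_inf; first by have [] := norm_set_inf q.
move=> _ [x <- <-]; rewrite ler_pdivrMl// -nrmZ.
by rewrite -quotient_piZ; exact: quotient_norm_pi.
Qed.

Let normZ k q : quotient_norm (k *: q) = toR `|k| * quotient_norm q.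
Proof.
apply/eqP; rewrite eq_le normZ_le/=.
have [->|k0] := eqVneq k 0.
  by rewrite normr0 -[X in toR X](ofR0 R s) ofRK mul0r norm_ge0.
have k0' : 0 < toR `|k|.
  by rewrite -(ltr_ofR s) toRK// ofR0 normr_gt0.
have kV : toR `|k| * toR `|k^-1| = 1.
  apply: (can_inj (@ofRK R s)).
  by rewrite ofRM !toRK// -normrM mulfV// normr1 ofR1.
have := normZ_le k^-1 (k *: q); rewrite scalerA mulVf// scale1r.
by rewrite -(ler_pM2l k0') mulrA kV mul1r.
Qed.

Let norm0 q : quotient_norm q = 0 -> q = 0.
Proof.
have [x <-] := piP q => x0.
have /choice[v vP] n :
    exists v, quotient_pi v = quotient_pi x /\ nrm v < n.+1%:R^-1.
  have [|v v1 v2] := @norm_lt (quotient_pi x) n.+1%:R^-1; last by exists v.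
  by rewrite x0.
rewrite -pi0; apply/pi_eq; rewrite subr0; apply/subspace_predP.
have cv : (fun n => x - v n) @ \oo --> x.
  apply/cvg_nrmP => e e0; near=> n.
  rewrite opprB addrC subrK; apply: lt_trans (vP n).2 _.
  by near: n; exact: near_infty_natSinv_lt (PosNum e0).
apply: (closed_cvg _ (@subspace_closed _ _ _ E) _ _ cv).
by apply: nearW => n; apply/subspace_predP/pi_eq; rewrite (vP n).1.
Unshelve. all: by end_near. Qed.

Let normK (q : quotient_by) : K := ofR (quotient_norm q).
Let normKD q r : normK (q + r) <= normK q + normK r.
Proof. by rewrite /normK -ofRD ler_ofR. Qed.
Let normKZ k q : normK (k *: q) = `|k| * normK q.
Proof. by rewrite /normK normZ ofRM toRK. Qed.
Let normK0 q : normK q = 0 -> q = 0.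
Proof. by rewrite -(ofR0 R s) => /(can_inj (@ofRK R s)); exact: norm0. Qed.

HB.instance Definition _ :=
  @Lmodule_isNormed.Build K quotient_by normK normKD normKZ normK0.

Lemma nrm_quotient (q : quotient_by) : nrm q = quotient_norm q.
Proof. exact: ofRK. Qed.

Let quotient_cvg (F : set_system quotient_by) :
  ProperFilter F -> cauchy F -> cvg F.
Proof.
apply: complete_fast => u fu.
have /choice[v vP] n :
    exists v, quotient_pi v = u n.+1 - u n /\ nrm v < 2^-1 ^+ n.
  have [|v v1 v2] := @norm_lt (u n.+1 - u n) (2^-1 ^+ n); last by exists v.
  by rewrite -nrm_quotient; exact: fu.
pose w := fix w n := if n is m.+1 then w m + v m else repr (u 0%N).
have wu n : quotient_pi (w n) = u n.
  elim: n => [|n IH]; first exact: pi_repr.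
  by rewrite [LHS]quotient_piD IH (vP n).1 addrC subrK.
have [l wl] : exists l : X, w @ \oo --> l.
  by apply: fast_cvg => n; rewrite [w n.+1]/= addrAC subrr add0r (vP n).2.
exists (quotient_pi l); apply/cvg_nrmP => e e0.
have /cvg_nrmP/(_ e e0) := wl; apply: filterS => n; apply: le_lt_trans.
by rewrite -wu -piN -quotient_piD nrm_quotient quotient_norm_pi.
Qed.

HB.instance Definition _ := Uniform_isComplete.Build quotient_by quotient_cvg.

End quotient.

#[local] Obligation Tactic := idtac.

Section operators.
Variables (R : realType) (s : scalars).
Local Notation K := (scalar_field R s).
Implicit Types X Y Z : normedModType K.

Record operator X Y := Operator {
  opfun :> X -> Y;
  op_linear : linear opfun;
  op_bounded : exists c : R, forall x, nrm (opfun x) <= c * nrm x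
}.

HB.instance Definition _ X Y (T : operator X Y) :=
  GRing.isLinear.Build K X Y *:%R (opfun T) (op_linear T).

Definition opnorm X Y (T : operator X Y) : R :=
  sup [set nrm (T x) | x in [set x : X | nrm x <= 1]].

Program Definition op_id X : operator X X := @Operator X X id _ _.
Next Obligation. by move=> X k x y. Qed.
Next Obligation. by move=> X; exists 1 => x; rewrite mul1r. Qed.

Program Definition op_comp X Y Z (U : operator Y Z) (T : operator X Y) :
  operator X Z := @Operator X Z (fun x => U (T x)) _ _.
Next Obligation. by move=> X Y Z U T k x y; rewrite !linearP. Qed.
Next Obligation.
move=> X Y Z U T; have [c cP] := op_bounded U; have [d dP] := op_bounded T.
exists (`|c| * d) => x; rewrite -mulrA (le_trans (cP _))//.
by rewrite (le_trans (ler_wpM2r (nrm_ge0 _) (ler_norm c)))// ler_wpM2l.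
Qed.

Program Definition op_add X Y (S T : operator X Y) : operator X Y :=
  @Operator X Y (fun x => S x + T x) _ _.
Next Obligation.
by move=> X Y S T k x y; rewrite !linearP scalerDr addrACA.
Qed.
Next Obligation.
move=> X Y S T; have [c cP] := op_bounded S; have [d dP] := op_bounded T.
exists (c + d) => x; rewrite mulrDl (le_trans (ler_nrmD _ _))//.
by rewrite lerD.
Qed.

Program Definition op_sub X Y (S T : operator X Y) : operator X Y :=
  @Operator X Y (fun x => S x - T x) _ _.
Next Obligation.
by move=> X Y S T k x y; rewrite !linearP scalerDr addrACA.
Qed.
Next Obligation.
move=> X Y S T; have [c cP] := op_bounded S; have [d dP] := op_bounded T.
exists (c + d) => x; rewrite mulrDl (le_trans (ler_nrmD _ _))//.
by rewrite nrmN lerD.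
Qed.

Definition dual X := operator X (scalar_line R s).

Definition finite_rank X Y (T : operator X Y) :=
  exists n (y : 'I_n -> Y), forall x, exists c : 'I_n -> K,
    T x = \sum_(i < n) c i *: y i.

Definition approximable X Y (T : operator X Y) :=
  forall e : R, 0 < e ->
    exists2 F : operator X Y, finite_rank F & opnorm (op_sub T F) < e.

(* [is_trace U t]: [U] has finite rank, with trace [t]; the value does not
   depend on the representation of [U] as a sum of rank one operators. *)
Definition is_trace X (U : operator X X) (t : K) :=
  exists n (f : 'I_n -> dual X) (y : 'I_n -> X),
    (forall x, U x = \sum_(i < n) (f i x : K) *: y i) /\
    t = \sum_(i < n) (f i (y i) : K).

Definition is_hilbert X :=
  exists ip : X -> X -> K,
    [/\ forall z, scalar (ip^~ z),
        forall x y, ip y x = scalar_conj (ip x y) &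
        forall x, ip x x = `|x| ^+ 2].

Definition finite_dimensional (V : lmodType K) :=
  exists n (e : 'I_n -> V), forall x, exists c : 'I_n -> K,
    x = \sum_(i < n) c i *: e i.

End operators.

Section canonical_operators.
Variables (R : realType) (s : scalars).
Variables (X : completeNormedModType (scalar_field R s)).
Implicit Type E : closed_subspace X.

Program Definition op_inclusion E : operator (subspace_of E) X :=
  @Operator _ _ _ _ val _ _.
Next Obligation. by move=> E k x y; rewrite linearP. Qed.
Next Obligation. by move=> E; exists 1 => x; rewrite mul1r. Qed.

Program Definition op_quotient E : operator X (quotient_by E) :=
  @Operator _ _ _ _ (@quotient_pi _ _ _ E) _ _.
Next Obligation. by move=> E k x y; rewrite quotient_piD quotient_piZ. Qed.
Next Obligation.
by move=> E; exists 1 => x; rewrite mul1r nrm_quotient quotient_norm_pi.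
Qed.

End canonical_operators.

Section ideals.
Variables (R : realType) (s : scalars).
Local Notation K := (scalar_field R s).
Local Notation banach := (completeNormedModType K).

(* A class of operators with a functional on it. The values of [ideal_norm]
   outside of the class are irrelevant. *)
Record operator_class := OperatorClass {
  ideal_mem : forall X Y : banach, operator X Y -> Prop;
  ideal_norm : forall X Y : banach, operator X Y -> \bar R
}.

Implicit Types A B : operator_class.

(* Homogeneity and definiteness of [ideal_norm] follow from the ideal
   properties, since [ideal_norm A T] dominates the operator norm of [T]. *)
Record quasi_banach_ideal A : Prop := QuasiBanachIdeal {
  ideal_mem_id : ideal_mem A (op_id (scalar_line R s));
  ideal_mem_add : forall (X Y : banach) (S T : operator X Y),
    ideal_mem A S -> ideal_mem A T -> ideal_mem A (op_add S T);
  ideal_mem_comp : forall (X0 X Y Y0 : banach)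
    (S : operator X0 X) (T : operator X Y) (U : operator Y Y0),
    ideal_mem A T -> ideal_mem A (op_comp U (op_comp T S));
  ideal_norm_fin : forall (X Y : banach) (T : operator X Y),
    ideal_mem A T -> (0 <= ideal_norm A T < +oo)%E;
  ideal_norm_id : ideal_norm A (op_id (scalar_line R s)) = 1%E;
  ideal_norm_add : exists2 k : R, 1 <= k &
    forall (X Y : banach) (S T : operator X Y),
      ideal_mem A S -> ideal_mem A T ->
      (ideal_norm A (op_add S T) <= k%:E * (ideal_norm A S + ideal_norm A T))%E;
  ideal_norm_comp : forall (X0 X Y Y0 : banach)
    (S : operator X0 X) (T : operator X Y) (U : operator Y Y0),
    ideal_mem A T ->
    (ideal_norm A (op_comp U (op_comp T S)) <=
       (opnorm U)%:E * ideal_norm A T * (opnorm S)%:E)%E;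
  ideal_complete : forall (X Y : banach) (T_ : nat -> operator X Y),
    (forall n, ideal_mem A (T_ n)) ->
    (forall e : R, 0 < e -> exists N, forall m n, (N <= m)%N -> (N <= n)%N ->
      (ideal_norm A (op_sub (T_ m) (T_ n)) < e%:E)%E) ->
    exists2 T : operator X Y, ideal_mem A T &
      forall e : R, 0 < e -> exists N, forall n, (N <= n)%N ->
        (ideal_norm A (op_sub (T_ n) T) < e%:E)%E
}.

Definition banach_ideal A : Prop :=
  quasi_banach_ideal A /\
  forall (X Y : banach) (S T : operator X Y),
    ideal_mem A S -> ideal_mem A T ->
    (ideal_norm A (op_add S T) <= ideal_norm A S + ideal_norm A T)%E.

Definition ideal_sub A B : Prop :=
  forall (X Y : banach) (T : operator X Y), ideal_mem A T -> ideal_mem B T.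

Definition ideal_isometric A B : Prop :=
  forall (X Y : banach) (T : operator X Y),
    (ideal_mem A T <-> ideal_mem B T) /\
    (ideal_mem A T -> ideal_norm A T = ideal_norm B T).

Definition ideal_prod A B : operator_class := {|
  ideal_mem X Y T := exists (Z : banach) (S : operator X Z) (U : operator Z Y),
    [/\ ideal_mem B S, ideal_mem A U & T = op_comp U S];
  ideal_norm X Y T := ereal_inf [set r : \bar R |
    exists (Z : banach) (S : operator X Z) (U : operator Z Y),
      [/\ ideal_mem B S, ideal_mem A U, T = op_comp U S &
          r = (ideal_norm A U * ideal_norm B S)%E]]
|}.

Definition hilbert_ideal : operator_class := {|
  ideal_mem X Y T := exists (H : banach) (S : operator X H) (U : operator H Y),
    is_hilbert H /\ T = op_comp U S;
  ideal_norm X Y T := ereal_inf [set r : \bar R |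
    exists (H : banach) (S : operator X H) (U : operator H Y),
      [/\ is_hilbert H, T = op_comp U S & r = (opnorm U * opnorm S)%:E]]
|}.

Definition maximal_hull A : operator_class := {|
  ideal_mem X Y T :=
    forall (X0 Y0 : banach) (S : operator X0 X) (U : operator Y Y0),
      approximable S -> approximable U ->
      ideal_mem A (op_comp U (op_comp T S));
  ideal_norm X Y T := ereal_sup [set r : \bar R |
    exists (X0 Y0 : banach) (S : operator X0 X) (U : operator Y Y0),
      [/\ approximable S /\ opnorm S <= 1, approximable U /\ opnorm U <= 1 &
          r = ideal_norm A (op_comp U (op_comp T S))]]
|}.

Definition maximal A : Prop := ideal_isometric A (maximal_hull A).

(* A finite-dimensional subspace is automatically closed; asking [E] to be
   closed only serves to make [subspace_of E] a Banach space. *)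
Definition adjoint_norm A (X Y : banach) (T : operator X Y) : \bar R :=
  ereal_sup [set r : \bar R |
    exists (E : closed_subspace X) (F : closed_subspace Y)
           (S : operator (quotient_by F) (subspace_of E)) (t : K),
      [/\ finite_dimensional (subspace_of E) /\
            finite_dimensional (quotient_by F),
          ideal_mem A S /\ (ideal_norm A S <= 1)%E,
          is_trace (op_comp T (op_comp (op_inclusion E)
                      (op_comp S (op_quotient F)))) t &
          r = (toR `|t|)%:E]].

Definition adjoint_ideal A : operator_class := {|
  ideal_mem X Y T := (adjoint_norm A T < +oo)%E;
  ideal_norm X Y T := adjoint_norm A T
|}.

Definition summing_bound (X Y : banach) (T : operator X Y) (c : R) : Prop :=
  0 <= c /\
  forall n (x : 'I_n -> X),
    \sum_(i < n) nrm (T (x i)) <=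
    c * sup [set \sum_(i < n) nrm (f (x i)) | f in
              [set f : dual X | opnorm f <= 1]].

Definition summing_ideal : operator_class := {|
  ideal_mem X Y T := exists c, summing_bound T c;
  ideal_norm X Y T := ereal_inf [set c%:E | c in [set c | summing_bound T c]]
|}.

Definition linfty_ideal : operator_class := adjoint_ideal summing_ideal.

End ideals.

Arguments hilbert_ideal R s : clear implicits.
Arguments summing_ideal R s : clear implicits.
Arguments linfty_ideal R s : clear implicits.

(* Main.v *)
Require Import Defs.
From mathcomp Require Import all_boot all_order all_algebra.
From mathcomp Require Import all_classical all_reals all_analysis.
From HB Require Import structures.
From mathcomp Require Import complex ring lra.

(** Let [N] be the quasi-norm of the product of [B] with the Hilbert operators,
and suppose that [N] is a norm.  A complete ideal norm is at most 1 on rank one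
operators [f (x) y] with [f] and [y] in the unit balls, so an operator ideal
with a complete norm contains every nuclear operator
([nuclear_in_banach_ideal]).  In particular it contains the diagonal operator
from [l_oo] to [l_1] that sends the [i]-th unit vector to [i ^ (-3/2)] times
the [i]-th unit vector ([diagonal_in_banach_ideal]).

The diagonal operator does not factor as [V S] with [S] from [l_oo] to a
Hilbert space [H] and [V] from [H] to [l_1] in [L_oo]
([no_hilbert_linfty_factorization]), which contradicts that [B] lies in [L_oo].
Put [h_i = S e_i].

- Choosing signs one after the other by the parallelogram law gives
  [sum_i |h_i|^2 <= |S|^2] ([sqr_sum_images_le]).

- The functionals [f_i = e_i' V] on [H] satisfy
  [f_i(h_j) = lambda_i delta_ij].  Orthonormalizing the [h_i] produces [g_i]
  with [f_i(g_i) = lambda_i / |w_i|], where [w_i] is the component of [h_i]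
  orthogonal to its predecessors, hence [f_i(g_i) >= lambda_i / |h_i|]
  ([gram_schmidt_biorthogonal]).

- The operator [u] from [l_1] to [H] that maps [y] to [sum_(i < n) y_i g_i] has
  1-summing norm at most 2, since by Khintchine's inequality the Euclidean norm
  of [(y_i)] is controlled by the average of the functionals
  [y |-> sum_i +- y_i], all of norm at most 1 on [l_1].  Trace duality between
  [L_oo] and the 1-summing operators therefore bounds
  [tr (V u) = sum_(i < n) f_i(g_i)] independently of [n]
  ([trace_le_adjoint_norm]).

So both [sum_i lambda_i / |h_i|] and [sum_i |h_i|^2] converge.  By the
inequality between arithmetic and geometric means,
[3 lambda^(2/3) <= 2 lambda / h + h^2], so [sum_i lambda_i^(2/3)] would
converge as well; for [lambda_i = i^(-3/2)] it is the harmonic series. *)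

Set Implicit Arguments.
Unset Strict Implicit.
Unset Printing Implicit Defensive.

Import Order.TTheory GRing.Theory Num.Theory.
Import numFieldNormedType.Exports.

Local Open Scope classical_set_scope.
Local Open Scope ring_scope.

(** * Operators, quotients and subspaces *)

Section scalar_modulus.
Variables (R : realType) (s : scalars).
Local Notation K := (scalar_field R s).
Implicit Types (x y : K) (V : normedModType K).

Definition modulus x : R := toR `|x|.

Lemma nrm_line x : nrm (x : scalar_line R s) = modulus x.
Proof. by []. Qed.

Lemma modulusE x : ofR (modulus x) = `|x| :> K.
Proof. by rewrite toRK. Qed.

Lemma nrm_scale V x (v : V) : nrm (x *: v) = modulus x * nrm v.
Proof. exact: nrmZ. Qed.

Lemma ler_nrm_sum V I (r : seq I) (P : pred I) (v : I -> V) :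
  nrm (\sum_(i <- r | P i) v i) <= \sum_(i <- r | P i) nrm (v i).
Proof.
elim/big_rec2: _ => [|i y x _ yx]; first by rewrite nrm0.
by rewrite (le_trans (ler_nrmD _ _))// lerD2l.
Qed.

Lemma modulus_ge0 x : 0 <= modulus x.
Proof. exact: (@nrm_ge0 R s (scalar_line R s)). Qed.

Lemma modulus0 : modulus 0 = 0.
Proof. exact: (@nrm0 R s (scalar_line R s)). Qed.

Lemma modulus0_eq0 x : modulus x = 0 -> x = 0.
Proof. exact: (@nrm0_eq0 R s (scalar_line R s)). Qed.

Lemma modulusN x : modulus (- x) = modulus x.
Proof. exact: (@nrmN R s (scalar_line R s)). Qed.

Lemma ler_modulusD x y : modulus (x + y) <= modulus x + modulus y.
Proof. exact: (@ler_nrmD R s (scalar_line R s)). Qed.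

Lemma ler_modulus_sum I (r : seq I) (P : pred I) (v : I -> K) :
  modulus (\sum_(i <- r | P i) v i) <= \sum_(i <- r | P i) modulus (v i).
Proof. exact: (@ler_nrm_sum (scalar_line R s)). Qed.

Lemma modulusM x y : modulus (x * y) = modulus x * modulus y.
Proof. by apply: (can_inj (@ofRK R s)); rewrite ofRM !modulusE normrM. Qed.

Lemma modulus_ofR (r : R) : 0 <= r -> modulus (ofR r) = r.
Proof.
move=> r0; apply: (can_inj (@ofRK R s)); rewrite modulusE ger0_norm//.
by rewrite -(ofR0 R s) ler_ofR.
Qed.

Lemma modulus1 : modulus 1 = 1.
Proof. by rewrite -(ofR1 R s) modulus_ofR. Qed.

Lemma modulus_sign (b : bool) : modulus ((-1) ^+ b) = 1.
Proof. by case: b; rewrite ?expr1 ?expr0 ?modulusN modulus1. Qed.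

Lemma ofR_sum I (r : seq I) (P : pred I) (v : I -> R) :
  ofR (\sum_(i <- r | P i) v i) = \sum_(i <- r | P i) ofR (v i) :> K.
Proof. by apply: (big_morph _ (@ofRD R s) (ofR0 R s)). Qed.

Lemma modulus_parallelogram x y :
  modulus (x + y) ^+ 2 + modulus (x - y) ^+ 2 =
  2 * (modulus x ^+ 2 + modulus y ^+ 2).
Proof.
rewrite /modulus; move: x y; case: s => /= x y.
  by rewrite !real_normK ?num_real//; ring.
case: x y => [a b] [c d] /=.
by rewrite !sqr_sqrtr ?addr_ge0 ?sqr_ge0//; ring.
Qed.

End scalar_modulus.

Section operator_theory.
Variables (R : realType) (s : scalars).
Local Notation K := (scalar_field R s).
Implicit Types X Y Z : normedModType K.

(** The bound of an operator is only asserted to exist, so two operators with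
the same values are equal by proof irrelevance. *)
Lemma operatorP X Y (S T : operator X Y) : S =1 T -> S = T.
Proof.
case: S T => [f fl fb] [g gl gb] /= /funext fg; subst g.
by congr Operator; exact: Prop_irrelevance.
Qed.

Lemma opnorm_le X Y (T : operator X Y) (c : R) : 0 <= c ->
  (forall x, nrm (T x) <= c * nrm x) -> opnorm T <= c.
Proof.
move=> c0 Tc; apply: sup_le_ub.
  by exists (nrm (T 0)), 0 => //=; rewrite nrm0.
move=> _ [x /= x1 <-]; apply: le_trans (Tc x) _.
by rewrite -[leRHS]mulr1 ler_wpM2l.
Qed.

Lemma nrm_le_opnorm X Y (T : operator X Y) x : nrm x <= 1 ->
  nrm (T x) <= opnorm T.
Proof.
move=> x1; apply: sup_upper_bound; last by exists x.
split; first by exists (nrm (T x)), x.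
have [c Tc] := op_bounded T; exists `|c| => _ [y /= y1 <-].
apply: le_trans (Tc y) _; rewrite -[leRHS]mulr1.
apply: le_trans (ler_wpM2r (nrm_ge0 _) (ler_norm c)) _.
exact: ler_wpM2l.
Qed.

Lemma opnorm_ge0 X Y (T : operator X Y) : 0 <= opnorm T.
Proof.
apply: le_trans (nrm_ge0 (T 0)) (nrm_le_opnorm T _).
by rewrite nrm0.
Qed.

Lemma nrm_op_le X Y (T : operator X Y) x : nrm (T x) <= opnorm T * nrm x.
Proof.
have [x0|x0] := eqVneq (nrm x) 0.
  by rewrite (nrm0_eq0 x0) linear0 !nrm0 mulr0.
have xp : 0 < nrm x by rewrite lt_neqAle eq_sym x0 nrm_ge0.
have /nrm_le_opnorm-/(_ Y T) : nrm (ofR (nrm x)^-1 *: x) <= 1.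
  by rewrite nrm_scale modulus_ofR ?invr_ge0 ?nrm_ge0// mulVf.
by rewrite linearZ nrm_scale modulus_ofR ?invr_ge0 ?nrm_ge0// ler_pdivrMl// mulrC.
Qed.

Lemma closed_op_kernel X Y (T : operator X Y) : closed [set x | T x = 0].
Proof.
rewrite closure_id; apply/seteqP; split; first exact: subset_closure.
move=> x clx /=; apply: nrm0_eq0; apply/eqP; rewrite eq_le nrm_ge0 andbT.
apply/ler_addgt0Pr => e e0; rewrite add0r.
have [c c0 Tc] : exists2 c : R, 0 < c & forall y, nrm (T y) <= c * nrm y.
  exists (opnorm T + 1); first by rewrite ltr_wpDl// opnorm_ge0.
  by move=> y; rewrite mulrDl mul1r (le_trans (nrm_op_le T y))// lerDl nrm_ge0.
have [|y [/= Ty0 /= xy]] := clx [set y | nrm (x - y) < e / c].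
  have /cvg_nrmP : (fun y : X => y) @ nbhs x --> x by exact: cvg_id.
  by apply; rewrite divr_gt0.
rewrite -(subr0 (T x)) -Ty0 -linearB.
by apply: le_trans (Tc _) _; rewrite -ler_pdivlMl// mulrC ltW.
Qed.

End operator_theory.

Section canonical_factorizations.
Variables (R : realType) (s : scalars).
Local Notation K := (scalar_field R s).

(** Trace duality evaluates an operator with values in a subspace; the norm is
unchanged, so a summing bound passes through. *)
Lemma op_corestrict (Y : normedModType K) (X : completeNormedModType K)
    (E : closed_subspace X) (T : operator Y X) :
  (forall y, subspace_set E (T y)) ->
  exists2 U : operator Y (subspace_of E),
    forall y, op_inclusion E (U y) = T y & forall y, nrm (U y) = nrm (T y).
Proof.
move=> ET.
have ET' y : T y \in subspace_pred E by exact/subspace_predP.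
pose u (y : Y) : subspace_of E := Sub (T y) (ET' y).
have uT y : val (u y) = T y by rewrite SubK.
have ul : linear u by move=> k x y; apply: val_inj; rewrite linearP !uT linearP.
have nu y : nrm (u y) = nrm (T y) by rewrite -uT.
have ub : exists c : R, forall y, nrm (u y) <= c * nrm y.
  by exists (opnorm T) => y; rewrite nu; exact: nrm_op_le.
by exists (Operator ul ub).
Qed.

Lemma op_quotient_factor (X : completeNormedModType K) (Z : normedModType K)
    (F : closed_subspace X) (T : operator X Z) :
  (forall x, subspace_set F x -> T x = 0) ->
  exists2 U : operator (quotient_by F) Z,
    forall x, U (op_quotient F x) = T x & opnorm U <= opnorm T.
Proof.
move=> FT.
have Tpi x y : quotient_pi F x = quotient_pi F y -> T x = T y.
  move=> xy; apply/eqP; rewrite -subr_eq0 -linearB; apply/eqP/FT/subspace_predP.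
  by rewrite (Quotient.idealrBE (subspace_pred F)); apply/eqP; exact: xy.
have piK (q : quotient_by F) : quotient_pi F (repr q) = q by exact: reprK.
pose u (q : quotient_by F) : Z := T (repr q).
have uT x : u (quotient_pi F x) = T x by apply: Tpi; rewrite piK.
have ul : linear u.
  move=> k p q; rewrite -(piK p) -(piK q) -quotient_piZ -quotient_piD !uT.
  by rewrite linearP.
have nu q : nrm (u q) <= opnorm T * nrm q.
  apply/ler_addgt0Pr => e e0.
  pose c := opnorm T + 1.
  have c0 : 0 < c by rewrite ltr_wpDl// opnorm_ge0.
  have [_ [x qx <-] xe] : exists2 r, [set nrm x | x in [set x | quotient_pi F x = q]] r
     & r < nrm q + e / c.
    apply: inf_lt; last by rewrite nrm_quotient ltrDl divr_gt0.
    by exists (nrm (repr q)), (repr q).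
  rewrite -qx uT; apply: le_trans (nrm_op_le T x) _; rewrite qx.
  apply: le_trans (ler_wpM2l (opnorm_ge0 T) (ltW xe)) _.
  rewrite mulrDr lerD2l mulrCA -[leRHS]mulr1 ler_wpM2l ?ltW//.
  by rewrite ltr_pdivrMr// mul1r /c ltrDl.
have ub : exists c : R, forall q, nrm (u q) <= c * nrm q by exists (opnorm T).
exists (Operator ul ub); first exact: uT.
by apply: opnorm_le => [|q]; [exact: opnorm_ge0|exact: nu].
Qed.

End canonical_factorizations.

(** * Spaces of sequences *)

(** A family of finite sets of indices covering [nat].  The supremum over the
windows [W n] of [sum_(i <- W n) |x i|] is the norm of [l_oo] when the windows
are the singletons, and that of [l_1] when they are the initial segments.
Treating both at once gives a single proof of completeness. *)
Record windows := Windows {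
  window :> nat -> seq nat;
  window_uniq : forall n, uniq (window n);
  window_cover : forall i, exists n, i \in window n
}.

Section sequence_space.
Variables (R : realType) (s : scalars) (W : windows).
Local Notation K := (scalar_field R s).

Definition window_sum (x : nat -> K) (n : nat) : R :=
  \sum_(i <- W n) modulus (x i).

Definition window_bounded : {pred nat -> K} :=
  fun x => `[< exists c, forall n, window_sum x n <= c >].

Lemma window_sumD (x y : nat -> K) n :
  window_sum (x + y) n <= window_sum x n + window_sum y n.
Proof.
by rewrite /window_sum -big_split; apply: ler_sum => i _; exact: ler_modulusD.
Qed.

Lemma window_sumZ (k : K) (x : nat -> K) n :
  window_sum (k *: x) n = modulus k * window_sum x n.
Proof. by rewrite mulr_sumr; apply: eq_bigr => i _; exact: modulusM. Qed.

Lemma window_bounded_submod : subsemimod_closed window_bounded.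
Proof.
split; first split.
- apply/asboolP; exists 0 => n.
  by rewrite /window_sum big1// => i _; exact: modulus0.
- move=> x y /asboolP[c xc] /asboolP[d yd]; apply/asboolP; exists (c + d) => n.
  by rewrite (le_trans (window_sumD _ _ _))// lerD.
- move=> k x /asboolP[c xc]; apply/asboolP; exists (modulus k * c) => n.
  by rewrite window_sumZ ler_wpM2l// modulus_ge0.
Qed.

HB.instance Definition _ :=
  GRing.isSubmodClosed.Build K (nat -> K) window_bounded window_bounded_submod.

Definition sequence_space : Type := {x : nat -> K | x \in window_bounded}.
HB.instance Definition _ := SubChoice.on sequence_space.
HB.instance Definition _ := [SubChoice_isSubLmodule of sequence_space by <:].

Definition sequence_norm (x : sequence_space) : R :=
  sup (range (window_sum (val x))).

Lemma window_sum_le_norm x n : window_sum (val x) n <= sequence_norm x.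
Proof.
apply: sup_upper_bound; last by exists n.
split; first by exists (window_sum (val x) 0%N), 0%N.
by have /asboolP[c xc] := valP x; exists c => _ [m _ <-].
Qed.

Lemma sequence_norm_le (x : sequence_space) c :
  (forall n, window_sum (val x) n <= c) -> sequence_norm x <= c.
Proof.
move=> xc; apply: sup_le_ub; first by exists (window_sum (val x) 0%N), 0%N.
by move=> _ [m _ <-].
Qed.

Lemma coord_le_norm (x : sequence_space) i :
  modulus (val x i) <= sequence_norm x.
Proof.
have [n iW] := window_cover W i; apply: le_trans (window_sum_le_norm x n).
rewrite /window_sum (bigD1_seq i) ?window_uniq//= lerDl.
by apply: sumr_ge0 => j _; exact: modulus_ge0.
Qed.

Lemma sequence_norm_ge0 x : 0 <= sequence_norm x.
Proof. exact: le_trans (modulus_ge0 _) (coord_le_norm x 0). Qed.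

Let normD x y : sequence_norm (x + y) <= sequence_norm x + sequence_norm y.
Proof.
apply: sequence_norm_le => n; rewrite raddfD/=.
apply: le_trans (window_sumD _ _ _) _.
by apply: lerD; exact: window_sum_le_norm.
Qed.

Let normZ_le k x : sequence_norm (k *: x) <= modulus k * sequence_norm x.
Proof.
apply: sequence_norm_le => n; rewrite linearZ/= window_sumZ.
by rewrite ler_wpM2l ?modulus_ge0// window_sum_le_norm.
Qed.

Let normZ k x : sequence_norm (k *: x) = modulus k * sequence_norm x.
Proof.
apply/eqP; rewrite eq_le normZ_le/=.
have [->|k0] := eqVneq k 0.
  by rewrite modulus0 mul0r sequence_norm_ge0.
have := normZ_le k^-1 (k *: x); rewrite scalerA mulVf// scale1r.
move=> /(ler_wpM2l (modulus_ge0 k)).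
by rewrite mulrA -modulusM mulfV// modulus1 mul1r.
Qed.

Let norm0 x : sequence_norm x = 0 -> x = 0.
Proof.
move=> x0; apply: val_inj; apply/funext => i; apply: modulus0_eq0.
by apply/eqP; rewrite eq_le modulus_ge0 andbT -x0 coord_le_norm.
Qed.

Let normK (x : sequence_space) : K := ofR (sequence_norm x).
Let normKD x y : normK (x + y) <= normK x + normK y.
Proof. by rewrite /normK -ofRD ler_ofR. Qed.
Let normKZ k x : normK (k *: x) = `|k| * normK x.
Proof. by rewrite /normK normZ ofRM modulusE. Qed.
Let normK0 x : normK x = 0 -> x = 0.
Proof. by rewrite -(ofR0 R s) => /(can_inj (@ofRK R s)); exact: norm0. Qed.

HB.instance Definition _ :=
  @Lmodule_isNormed.Build K sequence_space normK normKD normKZ normK0.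

Lemma nrm_sequence (x : sequence_space) : nrm x = sequence_norm x.
Proof. exact: ofRK. Qed.

Let fast_dist (u : nat -> sequence_space) : fast_cauchy u ->
  forall n p, nrm (u (n + p)%N - u n) <= 2 * 2^-1 ^+ n.
Proof.
move=> fu n p; apply: (@le_trans _ _ (2 * 2^-1 ^+ n - 2 * 2^-1 ^+ (n + p))).
  elim: p => [|p IH]; first by rewrite addn0 !subrr nrm0.
  rewrite addnS -(subrK (u (n + p)%N) (u _)) -addrA.
  apply: le_trans (ler_nrmD _ _) _.
  apply: le_trans (lerD (ltW (fu _)) IH) _.
  by rewrite [in leRHS]exprS mulrA mulfV// mul1r; lra.
by rewrite gerBl mulr_ge0// exprn_ge0// invr_ge0.
Qed.

(* The coordinates of a fast Cauchy sequence converge.  As the norm is a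
   supremum of seminorms that read finitely many coordinates each, the distance
   of [u n] to the limit is at most the bound on the distances to later terms. *)
Let fast_sequence_cvg (u : nat -> sequence_space) :
  fast_cauchy u -> exists l : sequence_space, u @ \oo --> l.
Proof.
move=> fu.
have fc i : fast_cauchy (fun n => val (u n) i : scalar_line R s).
  move=> n; apply: le_lt_trans (fu n); rewrite nrm_sequence.
  by have := coord_le_norm (u n.+1 - u n) i; rewrite raddfB.
have /choice[l ul] i := fast_cvg (fc i).
have tail m n : window_sum (l - val (u n)) m <= 2 * 2^-1 ^+ n.
  apply/ler_addgt0Pr => e e0.
  pose d := e / (size (W m)).+1%:R.
  have d0 : 0 < d by rewrite divr_gt0.
  have [p ludp] : exists p, forall i, i \in W m ->
      modulus (l i - val (u (n + p)%N) i) <= d.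
    have : \forall p \near \oo, forall i, i \in W m ->
        modulus (l i - val (u (n + p)%N) i) <= d.
      elim: (window W m) => [|j t IH]; first by apply: nearW.
      have /cvg_nrmP/(_ _ d0) [N _ Nj] := ul j.
      near=> p; move=> i; rewrite in_cons => /predU1P[->|it].
        apply: ltW; rewrite -nrm_line; apply: Nj => /=.
        by rewrite (@leq_trans p) ?leq_addl//; near: p; exact: nbhs_infty_ge.
      by move: i it; near: p.
    by move=> /filter_ex.
  have -> : l - val (u n) = (l - val (u (n + p)%N)) + val (u (n + p)%N - u n).
    by rewrite raddfB addrA subrK.
  apply: le_trans (window_sumD _ _ _) _; rewrite addrC; apply: lerD.
    apply: le_trans (window_sum_le_norm _ _) _.
    by rewrite -nrm_sequence fast_dist.
  apply: (@le_trans _ _ (\sum_(i <- W m) d)).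
    by rewrite /window_sum !big_seq; apply: ler_sum => i /ludp.
  rewrite big_const_seq count_predT iter_addr_0 -mulr_natr /d.
  rewrite -mulrA -[leRHS]mulr1; apply: ler_wpM2l; first exact: ltW.
  by rewrite ler_pdivrMl// mulr1 ler_nat.
have lW : l \in window_bounded.
  apply/asboolP; exists (2 + sequence_norm (u 0%N)) => m.
  rewrite -(subrK (val (u 0%N)) l); apply: le_trans (window_sumD _ _ _) _.
  apply: lerD; last exact: window_sum_le_norm.
  by apply: le_trans (tail _ _) _; rewrite expr0 mulr1.
exists (Sub l lW : sequence_space); apply/cvg_nrmP => e e0.
have : \forall n \near \oo, `|0 - (2^-1 : R) ^+ n| < e / 2.
  have := @cvg_expr R (2^-1).
  rewrite ger0_norm ?invr_ge0// invf_lt1// ltr1n => /(_ isT).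
  by move=> /cvgrPdist_lt; apply; rewrite divr_gt0.
apply: filterS => n; rewrite sub0r normrN ger0_norm ?exprn_ge0 ?invr_ge0// => ne.
apply: (@le_lt_trans _ _ (2 * 2^-1 ^+ n)); last by rewrite mulrC -ltr_pdivlMr.
rewrite nrm_sequence; apply: sequence_norm_le => m.
by rewrite raddfB; exact: tail.
Unshelve. all: by end_near. Qed.

Let sequence_cvg (F : set_system sequence_space) :
  ProperFilter F -> cauchy F -> cvg F.
Proof. by apply: complete_fast; exact: fast_sequence_cvg. Qed.

HB.instance Definition _ := Uniform_isComplete.Build sequence_space sequence_cvg.

Lemma window_sum_unit j n : window_sum (fun i => (i == j)%:R) n <= 1.
Proof.
rewrite /window_sum; have [jW|jW] := boolP (j \in W n).
  rewrite (bigD1_seq j) ?window_uniq//= eqxx modulus1 big1 ?addr0//.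
  by move=> i /negPf ->; exact: modulus0.
rewrite big1_seq// => i /= iW; case: eqP => [ij|_]; last exact: modulus0.
by rewrite -ij iW in jW.
Qed.

Lemma unit_bounded j : (fun i => (i == j)%:R) \in window_bounded.
Proof. by apply/asboolP; exists 1; exact: window_sum_unit. Qed.

Definition unit_vector j : sequence_space :=
  Sub (fun i => (i == j)%:R : K) (unit_bounded j).

Lemma nrm_unit_vector j : nrm (unit_vector j) <= 1.
Proof.
by rewrite nrm_sequence; apply: sequence_norm_le; exact: window_sum_unit.
Qed.

Lemma coord_linear i : linear (fun x : sequence_space => val x i : scalar_line R s).
Proof. by move=> k x y; rewrite linearP. Qed.

Lemma coord_bounded i : exists c : R, forall x : sequence_space,
  nrm (val x i : scalar_line R s) <= c * nrm x.
Proof. by exists 1 => x; rewrite mul1r nrm_sequence coord_le_norm. Qed.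

Definition coordinate i : dual sequence_space :=
  Operator (coord_linear i) (coord_bounded i).

Lemma opnorm_coordinate i : opnorm (coordinate i) <= 1.
Proof.
by apply: opnorm_le => // x; rewrite mul1r nrm_sequence; exact: coord_le_norm.
Qed.

End sequence_space.

Arguments coordinate {R s W} i.
Arguments unit_vector {R s W} j.

Section concrete_spaces.
Variables (R : realType) (s : scalars).
Local Notation K := (scalar_field R s).

Lemma sup_windows_cover (i : nat) : exists n, i \in [:: n].
Proof. by exists i; rewrite mem_seq1. Qed.

Definition sup_windows : windows :=
  @Windows (fun n => [:: n]) (fun=> isT) sup_windows_cover.

Lemma sum_windows_uniq n : uniq (index_iota 0 n).
Proof. exact: iota_uniq. Qed.

Lemma sum_windows_cover (i : nat) : exists n, i \in index_iota 0 n.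
Proof. by exists i.+1; rewrite mem_index_iota leqnn. Qed.

Definition sum_windows : windows :=
  @Windows (index_iota 0) sum_windows_uniq sum_windows_cover.

Lemma nrm_sup_le (x : sequence_space R s sup_windows) (c : R) :
  (forall i, modulus (val x i) <= c) -> nrm x <= c.
Proof.
move=> xc; rewrite nrm_sequence; apply: sequence_norm_le => n.
by rewrite /window_sum big_seq1.
Qed.

Lemma sum_coords_le_nrm (x : sequence_space R s sum_windows) n :
  \sum_(i < n) modulus (val x i) <= nrm x.
Proof.
rewrite nrm_sequence; apply: le_trans (window_sum_le_norm x n).
by rewrite /window_sum/= big_mkord.
Qed.

End concrete_spaces.

(** * Khintchine's inequality *)

Section khintchine.
Variable R : realType.

(** Let [X = a + sum_i +- b_i] with independent random signs, [a2 = |a|^2] and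
[s2 = sum_i |b_i|^2].  The second moment of [|X|] is [a2 + s2] and the fourth
one is at most [a2^2 + 6 a2 s2 + 3 s2^2].  Since [t >= t^2 - t^4 / 6] for
[t >= 0], the potential bounds the mean of [|X|] from below, at the scale [v].
Working with the potential replaces expectations by the method of conditional
expectations.  For [v = 0] the value is 0, by the convention on inverses. *)
Definition moment_potential (v a2 s2 : R) : R :=
  (a2 + s2) / v - (a2 ^+ 2 + 6 * a2 * s2 + 3 * s2 ^+ 2) / (6 * v ^+ 3).

Lemma moment_potential_scale0 (a2 s2 : R) : moment_potential 0 a2 s2 = 0.
Proof.
by rewrite /moment_potential [0 ^+ 3]expr0n/= mulr0 !invr0 !mulr0 subr0.
Qed.

(** When no sign is left to choose the potential is a lower bound, because
[t^3 - 6 t + 6 > 0] for [t >= 0]. *)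
Lemma moment_potential_le (v a : R) : 0 <= v -> 0 <= a ->
  moment_potential v (a ^+ 2) 0 <= a.
Proof.
rewrite le_eqVlt => /predU1P[<-|v0] a0.
  by rewrite moment_potential_scale0.
pose t := a / v; have t0 : 0 <= t by rewrite divr_ge0// ltW.
have -> : a = v * t by rewrite /t mulrC divfK// gt_eqF.
have -> : moment_potential v ((v * t) ^+ 2) 0 = v * (t ^+ 2 - t ^+ 4 / 6).
  by rewrite /moment_potential; field; rewrite gt_eqF.
rewrite ler_pM2l//; clearbody t.
(* [t^3 - 6 t + 6] is minimal at the square root of 2; 10/7 is close enough to
   it for the factorization to leave positive remainders. *)
have h : 0 <= t * ((t - 10 / 7) ^+ 2 * (t + 20 / 7)).
  by apply: mulr_ge0 => //; apply: mulr_ge0; [exact: sqr_ge0|lra].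
rewrite -subr_ge0.
have t2 := sqr_ge0 t.
have -> : t - (t ^+ 2 - t ^+ 4 / 6) =
    (t * ((t - 10 / 7) ^+ 2 * (t + 20 / 7)) + 6 / 49 * t ^+ 2 + 58 / 343 * t) / 6.
  by field.
by move: h t2; lra.
Qed.

(** The scale [v = sqrt s2] makes the potential of a sum without constant term
a fixed fraction of its Euclidean norm. *)
Lemma moment_potential0 (v : R) : moment_potential v 0 (v ^+ 2) = v / 2.
Proof.
have [->|v0] := eqVneq v 0.
  by rewrite moment_potential_scale0 mul0r.
by rewrite /moment_potential; field.
Qed.

(** Fixing one sign replaces [a] by [a + b] or [a - b], of squared moduli [p] and
[q]; on average this does not decrease the potential.  The hypotheses on [p] and
[q] hold in every inner product space. *)
Lemma moment_potential_split (v a2 b2 s2 p q : R) : 0 <= v ->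
  0 <= a2 -> 0 <= b2 -> 0 <= s2 ->
  p + q = 2 * (a2 + b2) -> (p - q) ^+ 2 <= 16 * a2 * b2 ->
  2 * moment_potential v a2 (s2 + b2) <=
  moment_potential v p s2 + moment_potential v q s2.
Proof.
move=> v0 a0 b0 s0 pq pq2.
rewrite /moment_potential -subr_ge0.
have -> : (p + s2) / v - (p ^+ 2 + 6 * p * s2 + 3 * s2 ^+ 2) / (6 * v ^+ 3) +
   ((q + s2) / v - (q ^+ 2 + 6 * q * s2 + 3 * s2 ^+ 2) / (6 * v ^+ 3)) -
   2 * ((a2 + (s2 + b2)) / v -
    (a2 ^+ 2 + 6 * a2 * (s2 + b2) + 3 * (s2 + b2) ^+ 2) / (6 * v ^+ 3)) =
  (p + q - 2 * (a2 + b2)) / v +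
  (2 * (a2 ^+ 2 + 6 * a2 * (s2 + b2) + 3 * (s2 + b2) ^+ 2)
   - (p ^+ 2 + q ^+ 2 + 6 * (p + q) * s2 + 6 * s2 ^+ 2)) / (6 * v ^+ 3) by ring.
rewrite pq subrr mul0r add0r divr_ge0//; last by rewrite mulr_ge0// exprn_ge0.
have -> : p ^+ 2 + q ^+ 2 = ((p + q) ^+ 2 + (p - q) ^+ 2) / 2 by field.
rewrite pq; nra.
Qed.

Variable s : scalars.
Local Notation K := (scalar_field R s).

Lemma modulus_sqrB_le (x y : K) :
  (modulus (x + y) ^+ 2 - modulus (x - y) ^+ 2) ^+ 2 <=
  16 * modulus x ^+ 2 * modulus y ^+ 2.
Proof.
have x0 := modulus_ge0 x; have y0 := modulus_ge0 y.
have p0 := modulus_ge0 (x + y); have q0 := modulus_ge0 (x - y).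
have p1 := ler_modulusD x y; have := ler_modulusD x (- y); rewrite modulusN => q1.
have := modulus_parallelogram x y.
move: x0 y0 p0 q0 p1 q1.
set a := modulus x; set b := modulus y; set p := modulus (x + y).
set q := modulus (x - y) => x0 y0 p0 q0 p1 q1 pq.
have p2 : p ^+ 2 <= (a + b) ^+ 2 by rewrite ler_pXn2r// nnegrE addr_ge0.
have q2 : q ^+ 2 <= (a + b) ^+ 2 by rewrite ler_pXn2r// nnegrE addr_ge0.
have -> : 16 * a ^+ 2 * b ^+ 2 = (4 * a * b) ^+ 2 by ring.
rewrite -subr_ge0 subr_sqr mulr_ge0//; first by rewrite subr_ge0; nra.
by nra.
Qed.

(** Signs are chosen from the last coordinate to the first; at each step one of
the two choices does not decrease the total potential, by
[moment_potential_split]. *)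
Lemma sign_potential (J : finType) (v : J -> R) (n : nat) :
  (forall j, 0 <= v j) -> forall (A : J -> K) (a : J -> nat -> K),
  exists e : nat -> bool,
    \sum_j moment_potential (v j) (modulus (A j) ^+ 2)
             (\sum_(i < n) modulus (a j i) ^+ 2) <=
    \sum_j moment_potential (v j)
             (modulus (A j + \sum_(i < n) (-1) ^+ e i * a j i) ^+ 2) 0.
Proof.
move=> v0; elim: n => [|n IH] A a.
  exists (fun=> false); apply: ler_sum => j _.
  by rewrite !big_ord0 addr0.
pose S b := \sum_j moment_potential (v j) (modulus (A j + (-1) ^+ b * a j n) ^+ 2)
             (\sum_(i < n) modulus (a j i) ^+ 2).
have SS : 2 * \sum_j moment_potential (v j) (modulus (A j) ^+ 2)
             (\sum_(i < n.+1) modulus (a j i) ^+ 2) <= S false + S true.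
  rewrite mulr_sumr /S -big_split; apply: ler_sum => j _ /=.
  rewrite big_ord_recr/= expr0 mul1r expr1 mulN1r.
  apply: moment_potential_split; rewrite ?sqr_ge0//.
  - by apply: sumr_ge0 => i _; exact: sqr_ge0.
  - exact: modulus_parallelogram.
  - exact: modulus_sqrB_le.
have [b Sb] : exists b : bool, \sum_j moment_potential (v j) (modulus (A j) ^+ 2)
             (\sum_(i < n.+1) modulus (a j i) ^+ 2) <= S b.
  have [h|h] := leP (S true) (S false); [exists false|exists true]; lra.
have [e eP] := IH (fun j => A j + (-1) ^+ b * a j n) a.
exists (fun i => if i == n then b else e i).
apply: le_trans Sb (le_trans eP _); apply: ler_sum => j _.
rewrite [in leRHS]big_ord_recr/= eqxx -addrA [_ * a j n + _]addrC.
under [in leRHS]eq_bigr => i _ do rewrite (ltn_eqF (ltn_ord i)).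
by [].
Qed.

(** Khintchine's inequality between the first and the second moment, summed over
a finite family and evaluated at one choice of signs: this is the form in which
it bounds a 1-summing norm, as the same signs serve all the members. *)
Lemma sign_khintchine (J : finType) (n : nat) (a : J -> nat -> K) :
  exists e : nat -> bool,
    \sum_j Num.sqrt (\sum_(i < n) modulus (a j i) ^+ 2) <=
    2 * \sum_j modulus (\sum_(i < n) (-1) ^+ e i * a j i).
Proof.
pose v j := Num.sqrt (\sum_(i < n) modulus (a j i) ^+ 2).
have v0 j : 0 <= v j by exact: sqrtr_ge0.
have [e eP] := sign_potential n v0 (fun=> 0) a.
exists e; rewrite -ler_pdivrMl// mulrC mulr_suml.
apply: le_trans (le_trans _ eP) _; apply: ler_sum => j _.
  rewrite modulus0 expr0n/= -moment_potential0 sqr_sqrtr//.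
  by apply: sumr_ge0 => i _; exact: sqr_ge0.
by rewrite add0r moment_potential_le// modulus_ge0.
Qed.

End khintchine.

(** * Hilbert spaces *)

Section hilbert.
Variables (R : realType) (s : scalars).
Local Notation K := (scalar_field R s).
Variables (H : normedModType K) (ip : H -> H -> K).
Hypotheses (ip_scalar : forall z, scalar (ip^~ z))
  (ip_conj : forall x y, ip y x = scalar_conj (ip x y))
  (ip_norm : forall x, ip x x = `|x| ^+ 2).

Implicit Types (x y z : H) (k : K) (n : nat).

Lemma ipD x y z : ip (x + y) z = ip x z + ip y z.
Proof. by have := ip_scalar z 1 x y; rewrite scale1r mul1r. Qed.

Lemma ip0l z : ip 0 z = 0.
Proof. by apply: (addIr (ip 0 z)); rewrite -ipD !add0r. Qed.

Lemma ipZ k x z : ip (k *: x) z = k * ip x z.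
Proof. by have := ip_scalar z k x 0; rewrite !addr0 ip0l addr0. Qed.

Lemma ipN x z : ip (- x) z = - ip x z.
Proof. by rewrite -scaleN1r ipZ mulN1r. Qed.

Lemma ip_suml n (v : nat -> H) z :
  ip (\sum_(i < n) v i) z = \sum_(i < n) ip (v i) z.
Proof. exact: (big_morph (ip^~ z) (fun x y => ipD x y z) (ip0l z)). Qed.

Lemma ip_orthC x y : ip x y = 0 -> ip y x = 0.
Proof.
move=> xy; rewrite ip_conj xy /scalar_conj; case: s => //=.
exact: (rmorph0 (@conjc R)).
Qed.

Lemma ipDr x y z : ip z (x + y) = ip z x + ip z y.
Proof.
rewrite ip_conj ipD (ip_conj x) (ip_conj y); move: (ip x z) (ip y z).
by rewrite /scalar_conj; case: s => //= a b; rewrite rmorphD.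
Qed.

Lemma ip0r z : ip z 0 = 0.
Proof. exact: ip_orthC (ip0l z). Qed.

Lemma ipNr x z : ip z (- x) = - ip z x.
Proof. by apply: (addIr (ip z x)); rewrite -ipDr !addNr ip0r. Qed.

Lemma ip_sumr n (v : nat -> H) z :
  ip z (\sum_(i < n) v i) = \sum_(i < n) ip z (v i).
Proof. exact: (big_morph (ip z) (fun x y => ipDr x y z) (ip0r z)). Qed.

Lemma ip_nrm x : ip x x = ofR (nrm x ^+ 2).
Proof. by rewrite ip_norm -nrmE !expr2 ofRM. Qed.

Lemma ip_pythagoras x y :
  ip x y = 0 -> nrm (x + y) ^+ 2 = nrm x ^+ 2 + nrm y ^+ 2.
Proof.
move=> xy; apply: (can_inj (@ofRK R s)); rewrite ofRD -!ip_nrm ipD !ipDr.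
by rewrite xy (ip_orthC xy) addr0 add0r.
Qed.

Lemma ip_parallelogram x y :
  nrm (x + y) ^+ 2 + nrm (x - y) ^+ 2 = 2 * (nrm x ^+ 2 + nrm y ^+ 2).
Proof.
apply: (can_inj (@ofRK R s)); rewrite mulrDl mul1r !ofRD -!ip_nrm !ipD !ipDr.
by rewrite !ipN !ipNr; ring.
Qed.

(** By the parallelogram law one of [u + h] and [u - h] has squared norm at least
[|u|^2 + |h|^2]. *)
Lemma sign_sum_sqr_ge (h : nat -> H) n : exists e : nat -> bool,
  \sum_(i < n) nrm (h i) ^+ 2 <=
  nrm (\sum_(i < n) (-1) ^+ e i *: h i) ^+ 2.
Proof.
elim: n => [|n [e eP]].
  by exists (fun=> false); rewrite !big_ord0 nrm0 expr0n.
set u := (X in nrm X) in eP.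
have [b ub] : exists b : bool,
    nrm u ^+ 2 + nrm (h n) ^+ 2 <= nrm (u + (-1) ^+ b *: h n) ^+ 2.
  have := ip_parallelogram u (h n).
  have [h1|h1] := leP (nrm (u + h n) ^+ 2) (nrm (u - h n) ^+ 2) => h2.
    by exists true; rewrite expr1 scaleN1r; lra.
  by exists false; rewrite expr0 scale1r; lra.
exists (fun i => if i == n then b else e i).
rewrite !big_ord_recr/= eqxx.
under [in leRHS]eq_bigr => i _ do rewrite (ltn_eqF (ltn_ord i)).
by apply: le_trans ub; rewrite lerD2r.
Qed.

Definition orthonormal_upto (g : nat -> H) n :=
  forall i j, (i < n)%N -> (j < n)%N -> ip (g i) (g j) = (i == j)%:R.

Section orthonormal_family.
Variables (g : nat -> H) (n : nat).
Hypothesis go : orthonormal_upto g n.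

Definition ortho_proj x := \sum_(i < n) ip x (g i) *: g i.

Lemma ip_comb (c : nat -> K) j : (j < n)%N ->
  ip (\sum_(i < n) c i *: g i) (g j) = c j.
Proof.
move=> jn; rewrite (ip_suml _ (fun i => c i *: g i)) (bigD1 (Ordinal jn))//=.
rewrite ipZ go// eqxx mulr1.
rewrite big1 ?addr0// => i; rewrite -val_eqE/= => ij.
by rewrite ipZ go// (negPf ij) mulr0.
Qed.

Lemma ortho_proj_comb (c : nat -> K) :
  ortho_proj (\sum_(i < n) c i *: g i) = \sum_(i < n) c i *: g i.
Proof. by apply: eq_bigr => i _; rewrite ip_comb. Qed.

Lemma ip_proj_residue x j : (j < n)%N -> ip (x - ortho_proj x) (g j) = 0.
Proof.
move=> jn; rewrite ipD ipN (ip_comb (fun i => ip x (g i)))//.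
by rewrite subrr.
Qed.

Lemma nrm_proj x :
  nrm x ^+ 2 = nrm (x - ortho_proj x) ^+ 2 + nrm (ortho_proj x) ^+ 2.
Proof.
rewrite -ip_pythagoras ?subrK//; apply: ip_orthC.
rewrite (ip_suml _ (fun i => ip x (g i) *: g i)) big1// => i _.
by rewrite ipZ (ip_orthC (ip_proj_residue x _)) ?mulr0.
Qed.

Lemma nrm_residue_le x : nrm (x - ortho_proj x) <= nrm x.
Proof.
by rewrite -(@ler_pXn2r _ 2) ?nnegrE ?nrm_ge0// [leRHS]nrm_proj lerDl sqr_ge0.
Qed.

Lemma nrm_comb (c : nat -> K) :
  nrm (\sum_(i < n) c i *: g i) ^+ 2 = \sum_(i < n) modulus (c i) ^+ 2.
Proof.
apply: (can_inj (@ofRK R s)); rewrite -ip_nrm.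
rewrite (ip_sumr _ (fun i => c i *: g i)) ofR_sum.
apply: eq_bigr => i _.
have -> : ip (\sum_(j < n) c j *: g j) (c i *: g i) =
    ip (c i *: g i) (c i *: g i).
  rewrite (ip_suml _ (fun i => c i *: g i)) (bigD1 i)//=.
  rewrite [X in _ + X]big1 ?addr0// => j ji.
  by rewrite ipZ (ip_orthC _) ?mulr0// ipZ go// val_eqE eq_sym (negPf ji) mulr0.
have g1 : nrm (g i) ^+ 2 = 1.
  by apply: (can_inj (@ofRK R s)); rewrite -ip_nrm go// eqxx ofR1.
by rewrite ip_nrm nrm_scale exprMn g1 mulr1.
Qed.

End orthonormal_family.

(** With [w] the component of [h_n] orthogonal to the previous [g_i], the vector
[g_n] is [w / |w|].  The functional [f_n] vanishes on the previous [g_i], which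
lie in the span of the previous [h_i], so it sees only [h_n] in [w] and
[f_n(g_n) = lam_n / |w|] with [|w| <= |h_n|]; and [w] is nonzero since
[f_n(w) = lam_n] is. *)
Lemma gram_schmidt_biorthogonal (h : nat -> H) (f : nat -> dual H)
    (lam : nat -> R) n :
  (forall i, 0 < lam i) ->
  (forall i j, f i (h j) = (ofR (lam i) *+ (i == j) : K)) ->
  exists g, [/\ orthonormal_upto g n,
    forall i (k : nat), (i < n)%N -> (i < k)%N -> f k (g i) = 0 &
    forall i, (i < n)%N -> exists2 r : R,
      lam i / nrm (h i) <= r & f i (g i) = ofR r].
Proof.
move=> lam0 fh; elim: n => [|n [g [go gf gr]]].
  by exists (fun=> 0); split.
pose w := h n - ortho_proj g n (h n).
have fw (k : nat) : (n <= k)%N -> f k w = f k (h n).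
  move=> nk; rewrite linearB linear_sum big1 ?subr0// => i _.
  by rewrite linearZ/= gf ?scaler0// (leq_trans (ltn_ord i)).
have w0 : 0 < nrm w.
  rewrite lt_neqAle nrm_ge0 andbT eq_sym; apply/eqP => /nrm0_eq0 w0.
  have := fw n (leqnn n); rewrite w0 linear0 fh eqxx mulr1n -(ofR0 R s).
  by move=> /(can_inj (@ofRK R s)) l0; have := lam0 n; rewrite -l0 ltxx.
pose gn := ofR (nrm w)^-1 *: w.
have ipgn i : (i < n)%N -> ip gn (g i) = 0.
  by move=> i_n; rewrite ipZ ip_proj_residue// mulr0.
exists (fun i => if i == n then gn else g i); split.
- move=> i j; rewrite !ltnS [(i <= n)%N]leq_eqVlt [(j <= n)%N]leq_eqVlt.
  move=> /predU1P[->|i_n] /predU1P[->|j_n]; rewrite ?eqxx.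
  + apply: etrans (ip_nrm _) _; rewrite nrm_scale modulus_ofR ?invr_ge0 ?nrm_ge0//.
    by rewrite mulVf ?gt_eqF// expr1n ofR1.
  + by rewrite (ltn_eqF j_n) ipgn// gtn_eqF.
  + by rewrite (ltn_eqF i_n) (ip_orthC (ipgn _ _)).
  + by rewrite (ltn_eqF i_n) (ltn_eqF j_n) go.
- move=> i k; rewrite ltnS leq_eqVlt => /predU1P[->|i_n] ik.
    by rewrite eqxx linearZ/= fw ?(ltnW ik)// fh gtn_eqF// mulr0n scaler0.
  by rewrite (ltn_eqF i_n) gf.
- move=> i; rewrite ltnS leq_eqVlt => /predU1P[->|i_n]; last first.
    by rewrite (ltn_eqF i_n); exact: gr.
  exists (lam n / nrm w).
    rewrite ler_pM2l// lef_pV2 ?posrE//; first exact: nrm_residue_le.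
    exact: lt_le_trans w0 (nrm_residue_le go _).
  by rewrite eqxx linearZ/= fw// fh eqxx mulr1n mulrC ofRM.
Qed.

End hilbert.

(** * Nuclear operators in a Banach ideal *)

Section nuclear.
Variables (R : realType) (s : scalars).
Local Notation K := (scalar_field R s).
Local Notation line := (scalar_line R s).

Lemma ray_linear (Y : normedModType K) (y : Y) : linear (fun k : line => k *: y).
Proof. by move=> k a b; rewrite scalerDl scalerA. Qed.

Lemma ray_bounded (Y : normedModType K) (y : Y) :
  exists c : R, forall k : line, nrm (k *: y) <= c * nrm k.
Proof. by exists (nrm y) => k; rewrite nrm_scale mulrC. Qed.

Definition ray (Y : normedModType K) (y : Y) : operator line Y :=
  Operator (ray_linear y) (ray_bounded y).

Lemma opnorm_ray (Y : normedModType K) (y : Y) : opnorm (ray y) <= nrm y.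
Proof.
by apply: opnorm_le (nrm_ge0 y) _ => k; rewrite /= nrm_scale mulrC.
Qed.

Definition rank_one (X Y : normedModType K) (f : dual X) (y : Y) :
  operator X Y := op_comp (ray y) (op_comp (op_id _) f).

(** A recursive definition, rather than a map given by a sum, since ideals are
closed under the binary sum of operators. *)
Fixpoint nuclear_sum (X Y : normedModType K) (f : nat -> dual X) (y : nat -> Y)
    (c : nat -> K) n : operator X Y :=
  if n is m.+1 then op_add (nuclear_sum f y c m) (rank_one (f m) (c m *: y m))
  else rank_one (f 0%N) 0.

Lemma nuclear_sumE (X Y : normedModType K) (f : nat -> dual X) (y : nat -> Y)
    (c : nat -> K) n x :
  nuclear_sum f y c n x = \sum_(i < n) (f i x : K) *: (c i *: y i).
Proof.
elim: n => [|n IH]; first by rewrite big_ord0 /= scaler0.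
by rewrite big_ord_recr/= IH.
Qed.

Lemma nrm_dual_le (X : normedModType K) (f : dual X) x :
  modulus (f x) <= opnorm f * nrm x.
Proof. exact: (nrm_op_le f). Qed.

Lemma scale_linear (X : normedModType K) (k : K) : linear (fun x : X => k *: x).
Proof. by move=> a x y; rewrite scalerDr !scalerA mulrC. Qed.

Lemma scale_bounded (X : normedModType K) (k : K) :
  exists c : R, forall x : X, nrm (k *: x) <= c * nrm x.
Proof. by exists (modulus k) => x; rewrite nrm_scale. Qed.

Definition op_scale (X : normedModType K) (k : K) : operator X X :=
  Operator (@scale_linear X k) (@scale_bounded X k).

Variable A : operator_class R s.
Implicit Types X Y : completeNormedModType K.

Section quasi_banach.
Hypothesis Aq : quasi_banach_ideal A.

Lemma ideal_mem_sub X Y (S T : operator X Y) :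
  ideal_mem A S -> ideal_mem A T -> ideal_mem A (op_sub S T).
Proof.
move=> AS AT.
have -> : op_sub S T =
    op_add S (op_comp (op_scale Y (-1)) (op_comp T (op_id X))).
  by apply: operatorP => x /=; rewrite scaleN1r.
exact: (ideal_mem_add Aq AS (ideal_mem_comp Aq _ _ AT)).
Qed.

Lemma rank_one_mem X Y (f : dual X) (y : Y) : ideal_mem A (rank_one f y).
Proof. exact: (ideal_mem_comp Aq _ _ (ideal_mem_id Aq)). Qed.

Lemma nuclear_sum_mem X Y (f : nat -> dual X) (y : nat -> Y) c n :
  ideal_mem A (nuclear_sum f y c n).
Proof.
elim: n => [|n IH]; first exact: rank_one_mem.
exact: (ideal_mem_add Aq IH (rank_one_mem _ _)).
Qed.

Lemma ideal_norm_rank_one X Y (f : dual X) (y : Y) : opnorm f <= 1 ->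
  (ideal_norm A (rank_one f y) <= (nrm y)%:E)%E.
Proof.
move=> f1; apply: le_trans (ideal_norm_comp Aq _ _ (ideal_mem_id Aq)) _.
rewrite (ideal_norm_id Aq) mule1 -EFinM lee_fin -[leRHS]mulr1.
by apply: ler_pM; rewrite ?opnorm_ge0// opnorm_ray.
Qed.

(** If [c = f (T x)] is nonzero then the identity of the scalars factors as
[(c^-1 f) T (k |-> k x)], and it has ideal norm 1. *)
Lemma dual_le_ideal_norm X Y (T : operator X Y) (f : dual Y) x :
  ideal_mem A T ->
  ((modulus (f (T x)))%:E <= (opnorm f * nrm x)%:E * ideal_norm A T)%E.
Proof.
move=> AT; have /andP[AT0 _] := ideal_norm_fin Aq AT.
have fx0 : 0 <= opnorm f * nrm x by rewrite mulr_ge0 ?opnorm_ge0 ?nrm_ge0.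
have [c0|c0] := eqVneq (f (T x) : K) 0.
  by rewrite c0 modulus0 mule_ge0.
set c : K := f (T x) in c0 *.
have mc : 0 < modulus c.
  rewrite lt_neqAle modulus_ge0 andbT eq_sym.
  by apply: contra_neq c0; exact: modulus0_eq0.
pose f' : operator Y line := op_comp (ray (c^-1 : line)) f.
have idE : op_comp f' (op_comp T (ray x)) = op_id line.
  apply: operatorP => k /=; rewrite !linearZ/=.
  by rewrite -[LHS]/((k * c) * c^-1) mulfK.
have := ideal_norm_comp Aq (ray x) f' AT.
rewrite idE (ideal_norm_id Aq) => h.
have f'le : opnorm f' <= (modulus c)^-1 * opnorm f.
  apply: opnorm_le => [|y]; first by rewrite mulr_ge0 ?invr_ge0 ?modulus_ge0 ?opnorm_ge0.
  rewrite /= nrm_scale nrm_line mulrC -mulrA.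
  have -> : modulus c^-1 = (modulus c)^-1.
    apply: (mulfI (negbT (gt_eqF mc))).
    by rewrite -modulusM !mulfV ?modulus1// gt_eqF.
  by rewrite ler_wpM2l ?invr_ge0 ?modulus_ge0// nrm_dual_le.
have Afin : ideal_norm A T \is a fin_num.
  by rewrite ge0_fin_numE//; have /andP[] := ideal_norm_fin Aq AT.
have a0 : 0 <= fine (ideal_norm A T) by exact: fine_ge0.
move: h; rewrite -(fineK Afin) -!EFinM !lee_fin => h.
rewrite -[leLHS]mulr1 -ler_pdivlMl//; apply: le_trans h _.
rewrite !mulrA -mulrA [leRHS]mulrAC -[leRHS]mulrA.
by apply: ler_pM; rewrite ?opnorm_ge0 ?mulr_ge0 ?opnorm_ge0// ler_wpM2l// opnorm_ray.
Qed.

End quasi_banach.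

Hypothesis Ab : banach_ideal A.
Let Aq : quasi_banach_ideal A := Ab.1.

Lemma ideal_norm_nuclear_sum X Y (f : nat -> dual X) (y : nat -> Y) c n :
  (forall i, opnorm (f i) <= 1) -> (forall i, nrm (y i) <= 1) ->
  (ideal_norm A (nuclear_sum f y c n) <= (\sum_(i < n) modulus (c i))%:E)%E.
Proof.
move=> f1 y1; elim: n => [|n IH].
  rewrite big_ord0; apply: le_trans (ideal_norm_rank_one Aq 0 (f1 _)) _.
  by rewrite nrm0.
rewrite big_ord_recr/= EFinD.
apply: le_trans (Ab.2 _ _ _ _ (nuclear_sum_mem Aq _ _ _ _) (rank_one_mem Aq _ _)) _.
apply: leeD IH _; apply: le_trans (ideal_norm_rank_one Aq _ (f1 _)) _.
by rewrite lee_fin nrm_scale -[leRHS]mulr1 ler_wpM2l ?modulus_ge0.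
Qed.

(** The partial sums are Cauchy for the ideal norm by the triangle inequality
with constant 1, which a quasi-norm need not satisfy.  Their limit exists by
completeness and is identified by [dual_le_ideal_norm]. *)
Lemma nuclear_in_banach_ideal X Y (f : nat -> dual X) (y : nat -> Y)
    (lam : nat -> R) :
  (forall i, opnorm (f i) <= 1) -> (forall i, nrm (y i) <= 1) ->
  (forall i, 0 <= lam i) ->
  (forall e, 0 < e -> exists N, forall n, \sum_(i < n | (N <= i)%N) lam i < e) ->
  exists2 T : operator X Y, ideal_mem A T &
    forall x (g : dual Y),
    (fun n => g (\sum_(i < n) (f i x : K) *: (ofR (lam i) *: y i))) @ \oo --> g (T x).
Proof.
move=> f1 y1 lam0 lam_sum.
pose c i : K := ofR (lam i).
pose D := nuclear_sum f y c.
have D_mem n : ideal_mem A (D n) by exact: nuclear_sum_mem.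
have D_cauchy e : 0 < e -> exists N, forall m n, (N <= m)%N -> (N <= n)%N ->
    (ideal_norm A (op_sub (D m) (D n)) < e%:E)%E.
  move=> e0; have [N lamN] := lam_sum e e0; exists N => m n Nm Nn.
  (* The difference of two partial sums is again such a sum, whose coefficients
     vanish below [N]. *)
  pose d i : K := c i * ((i < m)%N%:R - (i < n)%N%:R).
  have -> : op_sub (D m) (D n) = nuclear_sum f y d (maxn m n).
    have DE p : (p <= maxn m n)%N -> forall x, D p x =
       \sum_(i < maxn m n) (f i x : K) *: ((c i * (i < p)%N%:R) *: y i).
      move=> pm x; rewrite nuclear_sumE.
      rewrite (big_ord_widen _ (fun i => (f i x : K) *: (c i *: y i)) pm).
      rewrite big_mkcond/=; apply: eq_bigr => i _; case: ifP => _.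
        by rewrite mulr1.
      by rewrite mulr0 scale0r scaler0.
    apply: operatorP => x; rewrite nuclear_sumE /=.
    rewrite (DE m) ?leq_maxl// (DE n) ?leq_maxr// -sumrB; apply: eq_bigr => i _.
    by rewrite -scalerBr -scalerBl /d mulrBr.
  apply: le_lt_trans (ideal_norm_nuclear_sum _ _ f1 y1) _.
  rewrite lte_fin; apply: le_lt_trans (lamN (maxn m n)).
  rewrite [leRHS]big_mkcond; apply: ler_sum => i _; rewrite /d modulusM.
  rewrite modulus_ofR//; case: (leqP N i) => Ni; last first.
    by rewrite !(leq_trans Ni)// subrr modulus0 mulr0.
  rewrite -[leRHS]mulr1 ler_wpM2l//.
  by case: (i < m)%N; case: (i < n)%N;
    rewrite ?subrr ?subr0 ?sub0r ?modulusN ?modulus0 ?modulus1.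
have [T AT DT] := ideal_complete Aq D_mem D_cauchy.
exists T => // x g; apply/(@cvg_nrmP R s line) => e e0.
pose b := opnorm g * nrm x + 1.
have b0 : 0 < b by rewrite ltr_wpDl// mulr_ge0 ?opnorm_ge0 ?nrm_ge0.
have [N DN] := DT (e / b) (divr_gt0 e0 b0).
exists N => // n /= Nn.
have -> : \sum_(i < n) (f i x : K) *: (ofR (lam i) *: y i) = D n x.
  by rewrite nuclear_sumE.
rewrite nrmB -linearB.
have ADT := ideal_mem_sub Aq (D_mem n) AT.
rewrite -lte_fin.
apply: le_lt_trans (dual_le_ideal_norm Aq g x ADT) _.
apply: (@le_lt_trans _ _ (b%:E * ideal_norm A (op_sub (D n) T))%E).
  have /andP[? _] := ideal_norm_fin Aq ADT.
  by apply: lee_wpmul2r => //; rewrite lee_fin lerDl.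
by rewrite -lte_pdivlMl// -EFinM mulrC DN.
Qed.

End nuclear.

(** * A lower bound for the adjoint of the 1-summing norm *)

Section trace.
Variables (R : realType) (s : scalars).
Local Notation K := (scalar_field R s).
Local Notation line := (scalar_line R s).
Local Notation l1 := (sequence_space R s sum_windows).

Section kernel.
Variables (X : completeNormedModType K) (Y : normedModType K) (T : operator X Y).

Lemma kernel0 : [set x | T x = 0] 0. Proof. exact: linear0. Qed.

Lemma kernelD x y :
  [set x | T x = 0] x -> [set x | T x = 0] y -> [set x | T x = 0] (x + y).
Proof. by move=> /= Tx Ty; rewrite linearD/= Tx Ty addr0. Qed.

Lemma kernelZ k x : [set x | T x = 0] x -> [set x | T x = 0] (k *: x).
Proof. by move=> /= Tx; rewrite linearZ/= Tx scaler0. Qed.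

Definition op_kernel : closed_subspace X :=
  ClosedSubspace kernel0 kernelD kernelZ (@closed_op_kernel R s X Y T).

End kernel.

Lemma op_quotient_eq0 (X : completeNormedModType K) (F : closed_subspace X) x :
  subspace_set F x -> op_quotient F x = 0.
Proof.
move=> Fx; rewrite -(linear0 (op_quotient F)).
have : x - 0 \in subspace_pred F by rewrite subr0; apply/subspace_predP.
by rewrite (Quotient.idealrBE (subspace_pred F)) => /eqP.
Qed.

Lemma op_quotient_surj (X : completeNormedModType K) (F : closed_subspace X)
    (q : quotient_by F) : exists x, q = op_quotient F x.
Proof. by exists (repr q); rewrite /= /quotient_pi reprK. Qed.

Variables (H : completeNormedModType K) (ip : H -> H -> K).
Hypotheses (ip_scalar : forall z, scalar (ip^~ z))
  (ip_conj : forall x y, ip y x = scalar_conj (ip x y))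
  (ip_norm : forall x, ip x x = `|x| ^+ 2).
Variables (g : nat -> H) (n : nat).
Hypothesis go : orthonormal_upto ip g n.

Let resid (x : H) := x - ortho_proj ip g n x.

Lemma residue_linear : linear resid.
Proof.
move=> k x y; rewrite /resid /ortho_proj scalerBr scaler_sumr addrACA -opprD.
rewrite -big_split; congr (_ - _); apply: eq_bigr => i _ /=.
by rewrite (ipD ip_scalar) (ipZ ip_scalar) scalerDl scalerA.
Qed.

Lemma residue_bounded : exists c : R, forall x, nrm (resid x) <= c * nrm x.
Proof.
by exists 1 => x; rewrite mul1r (nrm_residue_le ip_scalar ip_conj ip_norm go).
Qed.

(** Its kernel is the span of the [g_i], which is thus seen to be closed. *)
Definition op_residue : operator H H := Operator residue_linear residue_bounded.

(** The normalization that makes the 1-summing norm of [coords_to_hilbert] at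
most 1. *)
Definition one_half : K := ofR 2^-1.

Lemma modulus_one_half : modulus one_half = 2^-1.
Proof. by rewrite modulus_ofR// invr_ge0. Qed.

Definition coords_to_hilbert : operator l1 H :=
  nuclear_sum coordinate g (fun=> one_half) n.

Lemma coords_to_hilbertE y :
  coords_to_hilbert y = \sum_(i < n) (one_half * val y i) *: g i.
Proof.
by rewrite nuclear_sumE; apply: eq_bigr => i _; rewrite scalerA mulrC.
Qed.

Lemma nrm_coords_to_hilbert y : nrm (coords_to_hilbert y) =
  2^-1 * Num.sqrt (\sum_(i < n) modulus (val y i) ^+ 2).
Proof.
have S0 : 0 <= \sum_(i < n) modulus (val y i) ^+ 2.
  by apply: sumr_ge0 => i _; exact: sqr_ge0.
apply/eqP; rewrite -(@eqrXn2 _ 2)// ?nrm_ge0 ?mulr_ge0 ?invr_ge0 ?sqrtr_ge0//.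
rewrite coords_to_hilbertE.
rewrite (nrm_comb ip_scalar ip_conj ip_norm go (fun i => one_half * val y i)).
rewrite exprMn sqr_sqrtr// mulr_sumr; apply/eqP/eq_bigr => i _.
by rewrite modulusM modulus_one_half exprMn.
Qed.

Lemma coords_kernel (y : l1) i : (i < n)%N -> coords_to_hilbert y = 0 -> val y i = 0.
Proof.
move=> i_n uy; apply: modulus0_eq0; apply/eqP.
have := nrm_coords_to_hilbert y; rewrite uy nrm0 => /eqP.
rewrite eq_sym mulf_eq0 invr_eq0 pnatr_eq0/= sqrtr_eq0 => S0.
have : \sum_(i < n) modulus (val y i) ^+ 2 == 0.
  by rewrite eq_le S0 sumr_ge0// => j _; exact: sqr_ge0.
rewrite psumr_eq0 => [|j _]; last exact: sqr_ge0.
by move=> /allP/(_ (Ordinal i_n) (mem_index_enum _)); rewrite expf_eq0.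
Qed.

Definition sign_functional (e : nat -> bool) : dual l1 :=
  nuclear_sum coordinate (fun=> 1 : line) (fun i => (-1) ^+ e i) n.

Lemma sign_functionalE e y :
  (sign_functional e y : K) = \sum_(i < n) (-1) ^+ e i * val y i.
Proof.
rewrite nuclear_sumE; apply: eq_bigr => i _.
rewrite -[LHS]/(val y i * ((-1) ^+ e i * 1)).
by rewrite mulr1 mulrC.
Qed.

Lemma opnorm_sign_functional e : opnorm (sign_functional e) <= 1.
Proof.
apply: opnorm_le => // y; rewrite mul1r nrm_line sign_functionalE.
apply: le_trans (sum_coords_le_nrm y n).
apply: le_trans (ler_modulus_sum _ _ _) _.
by apply: ler_sum => i _; rewrite modulusM modulus_sign mul1r.
Qed.

(** The adjoint norm is tested on the span [E] of the [g_i] and on the quotient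
by the kernel [F] of [coords_to_hilbert], through which that operator factors.
Its 1-summing norm is at most 1 by Khintchine's inequality, since the
functionals [sign_functional e] also factor through the quotient. *)
Lemma trace_le_adjoint_norm (V : operator H l1) :
  ((modulus (\sum_(i < n) ((coordinate i : dual l1) (V (one_half *: g i)) : K)))%:E <=
   adjoint_norm (summing_ideal R s) V)%E.
Proof.
pose u := coords_to_hilbert; pose F := op_kernel u; pose E := op_kernel op_residue.
have [U Uu _] : exists2 U : operator (quotient_by F) H,
    forall x, U (op_quotient F x) = u x & opnorm U <= opnorm u.
  by apply: op_quotient_factor => x.
have uE y : subspace_set E (u y).
  apply/eqP; rewrite subr_eq0 eq_sym /u coords_to_hilbertE; apply/eqP.
  exact: (ortho_proj_comb ip_scalar go (fun i => one_half * val y i)).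
have [S SU nS] : exists2 S : operator (quotient_by F) (subspace_of E),
    forall q, op_inclusion E (S q) = U q & forall q, nrm (S q) = nrm (U q).
  apply: op_corestrict => q; have [y ->] := op_quotient_surj q.
  by rewrite Uu.
have S_summing : summing_bound S 1.
  split=> // m x.
  have /choice[y xy] k := op_quotient_surj (x k).
  have [e eP] := sign_khintchine n (fun k i => val (y k) i).
  have [phi phiE phi1] : exists2 phi : dual (quotient_by F),
      forall y, phi (op_quotient F y) = sign_functional e y &
      opnorm phi <= opnorm (sign_functional e).
    apply: op_quotient_factor => z uz; rewrite -[LHS]/(sign_functional e z : K).
    rewrite sign_functionalE big1// => i _.
    by rewrite (coords_kernel (ltn_ord i) uz) mulr0.
  have -> : \sum_(k < m) nrm (S (x k)) =
      2^-1 * \sum_k Num.sqrt (\sum_(i < n) modulus (val (y k) i) ^+ 2).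
    rewrite mulr_sumr; apply: eq_bigr => k _.
    by rewrite nS xy Uu nrm_coords_to_hilbert.
  rewrite mul1r ler_pdivrMl//; apply: le_trans eP _; rewrite ler_pM2l//.
  apply: sup_upper_bound; last first.
    exists phi; first exact: le_trans phi1 (opnorm_sign_functional e).
    by apply: eq_bigr => k _; rewrite xy phiE nrm_line sign_functionalE.
  split; first by exists (\sum_(i < m) nrm (phi (x i))), phi => //=;
    exact: le_trans phi1 (opnorm_sign_functional e).
  exists (\sum_(i < m) nrm (x i)) => _ [f /= f1 <-]; apply: ler_sum => i _.
  apply: le_trans (nrm_op_le f (x i)) _.
  by rewrite -[leRHS]mul1r ler_wpM2r ?nrm_ge0.
apply: ereal_sup_ubound; exists E, F, S.
exists (\sum_(i < n) ((coordinate i : dual l1) (V (one_half *: g i)) : K)); split => //.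
- split.
    have gE (i : 'I_n) : g i \in subspace_pred E.
      apply/subspace_predP/eqP; rewrite subr_eq0 eq_sym; apply/eqP.
      rewrite /ortho_proj (bigD1 i)//= go// eqxx scale1r big1 ?addr0// => j ji.
      by rewrite go// val_eqE eq_sym (negPf ji) scale0r.
    exists n, (fun i : 'I_n => Sub (g i) (gE i) : subspace_of E) => x.
    exists (fun i => ip (val x) (g i)); apply: val_inj; rewrite raddf_sum.
    have /subspace_predP/eqP := valP x.
    by rewrite subr_eq0 => /eqP xE; rewrite [LHS]xE; apply: eq_bigr.
  exists n, (fun i : 'I_n => op_quotient F (unit_vector i)) => q.
  have [y ->] := op_quotient_surj q; exists (fun i => val y i).
  apply/eqP; rewrite -subr_eq0.
  have -> : \sum_(i < n) val y i *: op_quotient F (unit_vector i) =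
      op_quotient F (\sum_(i < n) val y i *: unit_vector i).
    by rewrite linear_sum; apply: eq_bigr => i _; rewrite linearZ.
  rewrite -linearB; apply/eqP/op_quotient_eq0.
  set z := y - _; suff z0 i : (i < n)%N -> val z i = 0.
    apply: etrans (coords_to_hilbertE z) _; rewrite big1// => i _.
    by rewrite z0// mulr0 scale0r.
  move=> i_n; rewrite -[LHS]/(coordinate i z : K) linearB linear_sum.
  rewrite (eq_bigr (fun j : 'I_n => val y j * (i == j)%:R : K)); last first.
    by move=> j _; rewrite linearZ.
  rewrite (bigD1 (Ordinal i_n))//= eqxx mulr1 big1 ?addr0 ?subrr// => j.
  by rewrite -val_eqE/= eq_sym => /negPf ->; rewrite mulr0.
- split; first by exists 1.
  by apply: ereal_inf_lbound; exists 1.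
- exists n, (fun i : 'I_n => (coordinate i : dual l1)),
    (fun i : 'I_n => V (one_half *: g i)).
  split=> // y; rewrite -[LHS]/(V (op_inclusion E (S (op_quotient F y)))).
  rewrite SU Uu /u nuclear_sumE linear_sum; apply: eq_bigr => i _.
  by rewrite linearZ.
Qed.

End trace.

(** * The diagonal operator *)

Section weights.
Variable R : realType.

Definition inv_sqrt (n : nat) : R := (Num.sqrt n%:R)^-1.

Lemma inv_sqrt_ge0 n : 0 <= inv_sqrt n.
Proof. by rewrite invr_ge0 sqrtr_ge0. Qed.

Lemma inv_sqrt_gt0 n : 0 < inv_sqrt n.+1.
Proof. by rewrite invr_gt0 sqrtr_gt0. Qed.

Lemma sqr_inv_sqrt n : inv_sqrt n ^+ 2 = n%:R^-1.
Proof. by rewrite exprVn sqr_sqrtr. Qed.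

(** With [a] and [b] the two inverse square roots, [a^2 - b^2 = a^2 b^2] and
[b <= a], so [2 (a - b) >= a b^2 >= b^3]. *)
Lemma inv_sqrt_telescope n : (0 < n)%N ->
  inv_sqrt n.+1 ^+ 3 + 2 * inv_sqrt n.+1 <= 2 * inv_sqrt n.
Proof.
case: n => // n _; have a0 := inv_sqrt_gt0 n; have b0 := inv_sqrt_gt0 n.+1.
have : inv_sqrt n.+1 ^+ 2 - inv_sqrt n.+2 ^+ 2 =
    inv_sqrt n.+1 ^+ 2 * inv_sqrt n.+2 ^+ 2.
  rewrite !sqr_inv_sqrt -[n.+2%:R]natr1.
  have : 0 < n.+1%:R :> R by [].
  move: (n.+1%:R : R) => x x0; field.
  by rewrite !gt_eqF// addr_gt0.
move: a0 b0; set a := inv_sqrt n.+1; set b := inv_sqrt n.+2 => a0 b0 ab.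
have ba : b <= a.
  have : b ^+ 2 <= a ^+ 2 by rewrite -subr_ge0 ab mulr_ge0 ?sqr_ge0.
  by rewrite ler_pXn2r// nnegrE ltW.
have h : a * b ^+ 2 <= 2 * (a - b).
  rewrite -(ler_pM2l a0) mulrA -expr2 -ab subr_sqr.
  by nra.
have : b * b ^+ 2 <= a * b ^+ 2 by rewrite ler_wpM2r ?sqr_ge0.
by rewrite -exprS; lra.
Qed.

Lemma weight_tail n m : (0 < n)%N -> (n <= m)%N ->
  \sum_(i < m | (n <= i)%N) inv_sqrt i.+1 ^+ 3 + 2 * inv_sqrt m <= 2 * inv_sqrt n.
Proof.
move=> n0; elim: m => [|m IH]; first by rewrite leqn0 => /eqP n0'; rewrite n0' in n0.
rewrite leq_eqVlt => /predU1P[->|].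
  rewrite big1 ?add0r// => i ni.
  by have := ltn_ord i; rewrite ltnNge ni.
rewrite ltnS => nm; rewrite big_mkcond big_ord_recr/= -big_mkcond nm.
have := inv_sqrt_telescope (leq_trans n0 nm); have := IH nm.
by lra.
Qed.

Lemma weight_summable (e : R) : 0 < e ->
  exists N, forall n, \sum_(i < n | (N <= i)%N) inv_sqrt i.+1 ^+ 3 < e.
Proof.
move=> e0; pose N := (Num.truncn ((2 / e) ^+ 2)).+1; exists N => n.
have Ne : 2 * inv_sqrt N < e.
  have N0 : 0 < Num.sqrt N%:R :> R by rewrite sqrtr_gt0.
  rewrite /inv_sqrt ltr_pdivrMr// mulrC -ltr_pdivrMr//.
  have : (2 / e) ^+ 2 < Num.sqrt N%:R ^+ 2 by rewrite sqr_sqrtr// truncnS_gt.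
  by rewrite ltr_pXn2r// nnegrE ltW// divr_gt0.
apply: le_lt_trans Ne.
have [Nn|nN] := leqP N n.
  have := weight_tail (ltn0Sn _) Nn; have := inv_sqrt_ge0 n.
  by rewrite -/N; lra.
rewrite big1 ?mulr_ge0 ?inv_sqrt_ge0// => i Ni.
by have := ltn_trans (ltn_ord i) nN; rewrite ltnNge Ni.
Qed.

Lemma harmonic_unbounded (c : R) : exists n, c < \sum_(i < n) inv_sqrt i.+1 ^+ 2.
Proof.
apply: contrapT => hc; apply: (@dvg_harmonic R).
apply: nondecreasing_is_cvgn.
  by apply: nondecreasing_series => i _ _; exact: harmonic_ge0.
exists c => _ [n _ <-]; rewrite leNgt; apply/negP => cn; apply: hc; exists n.
rewrite /series/= big_mkord in cn.
by under eq_bigr => i _ do rewrite sqr_inv_sqrt.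
Qed.

(** The inequality between arithmetic and geometric means for
[m^3 / h], [m^3 / h] and [h^2]. *)
Lemma sqr_le_cube_div_sqr (m h : R) : 0 <= m -> 0 < h ->
  3 * m ^+ 2 <= 2 * (m ^+ 3 / h) + h ^+ 2.
Proof.
move=> m0 h0; rewrite -(ler_pM2r h0).
have -> : (2 * (m ^+ 3 / h) + h ^+ 2) * h =
    3 * m ^+ 2 * h + (h - m) ^+ 2 * (h + 2 * m).
  by field; rewrite gt_eqF.
by rewrite lerDl mulr_ge0 ?sqr_ge0// addr_ge0 ?mulr_ge0// ltW.
Qed.

End weights.

Section diagonal.
Variables (R : realType) (s : scalars).
Local Notation K := (scalar_field R s).
Local Notation line := (scalar_line R s).
Local Notation c0 := (sequence_space R s sup_windows).
Local Notation l1 := (sequence_space R s sum_windows).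

(** [(i + 1) ^ (-3/2)]: summable, while its power 2/3 is the harmonic sequence. *)
Definition weight (i : nat) : R := inv_sqrt R i.+1 ^+ 3.

Lemma diagonal_in_banach_ideal (A : operator_class R s) : banach_ideal A ->
  exists2 T : operator c0 l1, ideal_mem A T &
    forall i j, coordinate i (T (unit_vector j)) = ofR (weight i) *+ (i == j) :> K.
Proof.
move=> Ab.
have [T AT Tlim] := nuclear_in_banach_ideal Ab
  (@opnorm_coordinate R s sup_windows) (@nrm_unit_vector R s sum_windows)
  (fun i => exprn_ge0 3 (@inv_sqrt_ge0 R i.+1)) (@weight_summable R).
exists T => // i j; have := Tlim (unit_vector j) (coordinate i).
set u := (fun n => _) => uT.
have {}uT : u @ \oo --> (coordinate i (T (unit_vector j)) : line) by exact: uT.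
have uc : u @ \oo --> (ofR (weight i) *+ (i == j) : line).
  apply: cvg_near_cst; exists i.+1 => // n /= i_n.
  rewrite /u linear_sum.
  rewrite (eq_bigr (fun k : 'I_n =>
    (val k == j :> nat)%:R * (ofR (weight k) * (i == k)%:R) : K)); last first.
    by move=> k _; rewrite !linearZ.
  rewrite (bigD1 (Ordinal i_n))//= big1 ?addr0; last first.
    by move=> k; rewrite -val_eqE/= eq_sym => /negPf ->; rewrite !mulr0.
  by rewrite eqxx mulr1 mulr_natl.
exact: (cvg_unique (@norm_hausdorff _ line) uT uc).
Qed.

Lemma nrm_sign_sum_le1 (e : nat -> bool) n :
  nrm (\sum_(i < n) ((-1) ^+ e i : K) *: (unit_vector i : c0)) <= 1.
Proof.
apply: nrm_sup_le => j.
have -> : val (\sum_(i < n) ((-1) ^+ e i : K) *: (unit_vector i : c0)) j =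
    \sum_(i < n) (-1) ^+ e i * (j == i)%:R.
  rewrite -[LHS]/(coordinate j _ : K) linear_sum.
  by apply: eq_bigr => i _; rewrite linearZ.
have [jn|nj] := ltnP j n.
  rewrite (bigD1 (Ordinal jn))//= eqxx mulr1 big1 ?addr0 ?modulus_sign// => i.
  by rewrite -val_eqE/= eq_sym => /negPf ->; rewrite mulr0.
rewrite big1 ?modulus0// => i _.
by rewrite gtn_eqF ?mulr0// (leq_trans (ltn_ord i)).
Qed.

(** A sum of unit vectors with signs has norm at most 1 in [l_oo], so its image
has norm at most [opnorm S]. *)
Lemma sqr_sum_images_le (H : completeNormedModType K) (S : operator c0 H) n :
  is_hilbert H -> \sum_(i < n) nrm (S (unit_vector i)) ^+ 2 <= opnorm S ^+ 2.
Proof.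
move=> [ip [ip1 ip2 ip3]].
have [e eP] := sign_sum_sqr_ge ip1 ip2 ip3 (fun i => S (unit_vector i)) n.
apply: le_trans eP _.
have -> : \sum_(i < n) ((-1) ^+ e i : K) *: S (unit_vector i) =
    S (\sum_(i < n) ((-1) ^+ e i : K) *: (unit_vector i : c0)).
  by rewrite linear_sum; apply: eq_bigr => i _; rewrite linearZ.
rewrite ler_pXn2r// ?nnegrE ?nrm_ge0 ?opnorm_ge0//.
by apply: nrm_le_opnorm; exact: nrm_sign_sum_le1.
Qed.

(** A finite adjoint norm of [V] would bound [sum_i weight i / |S e_i|], hence,
by [sqr_le_cube_div_sqr] and [sqr_sum_images_le], the harmonic sums. *)
Lemma no_hilbert_linfty_factorization (H : completeNormedModType K)
    (S : operator c0 H) (V : operator H l1) :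
  is_hilbert H ->
  (forall i j, coordinate i (V (S (unit_vector j))) =
    ofR (weight i) *+ (i == j) :> K) ->
  adjoint_norm (summing_ideal R s) V = +oo%E.
Proof.
move=> hH VS; apply: eq_infty => C.
have [ip [ip1 ip2 ip3]] := hH.
pose h i := S (unit_vector i).
pose f i : dual H := op_comp (coordinate i) V.
have weight0 i : 0 < weight i by rewrite exprn_gt0// inv_sqrt_gt0.
have fh i j : f i (h j) = ofR (weight i) *+ (i == j) :> K by exact: VS.
have [n nC] := harmonic_unbounded ((4 * C + opnorm S ^+ 2) / 3).
have [g [go _ gr]] := gram_schmidt_biorthogonal ip1 ip2 ip3 n weight0 fh.
apply: le_trans (trace_le_adjoint_norm ip1 ip2 ip3 go V).
have h0 i : 0 < nrm (h i).
  rewrite lt_neqAle nrm_ge0 andbT eq_sym; apply/eqP => /nrm0_eq0 hi0.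
  have := fh i i; rewrite hi0 linear0 eqxx mulr1n -(ofR0 R s).
  by move=> /(can_inj (@ofRK R s)) w0; have := weight0 i; rewrite -w0 ltxx.
have /choice[r rP] (i : 'I_n) : exists r : R, weight i / nrm (h i) <= r /\
    f i (g i) = ofR r :> K.
  by have [r r1 r2] := gr i (ltn_ord i); exists r.
have r0 i : 0 <= r i.
  by apply: le_trans (rP i).1; rewrite divr_ge0 ?nrm_ge0 ?ltW.
have -> : \sum_(i < n) (coordinate i (V (one_half R s *: g i)) : K) =
    ofR (2^-1 * \sum_(i < n) r i).
  rewrite mulr_sumr ofR_sum; apply: eq_bigr => i _.
  by rewrite !linearZ ofRM -(rP i).2.
rewrite modulus_ofR; last by rewrite mulr_ge0 ?invr_ge0 ?sumr_ge0.
rewrite lee_fin.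
have sum_r : 3 * \sum_(i < n) inv_sqrt R i.+1 ^+ 2 <=
    2 * \sum_(i < n) r i + opnorm S ^+ 2.
  apply: le_trans (lerD (lexx _) (sqr_sum_images_le S n hH)).
  rewrite !mulr_sumr -big_split; apply: ler_sum => i _ /=.
  apply: le_trans (sqr_le_cube_div_sqr (inv_sqrt_ge0 R i.+1) (h0 i)) _.
  by rewrite lerD2r ler_pM2l// (rP i).1.
by move: nC; rewrite ltr_pdivrMr//; lra.
Qed.

End diagonal.

Theorem theorem3p5 (R : realType) (s : scalars) (B : operator_class R s) :
  banach_ideal B -> maximal B -> ideal_sub B (linfty_ideal R s) ->
  ~ banach_ideal (ideal_prod B (hilbert_ideal R s)).
Proof.
move=> [Bq _] _ BL /diagonal_in_banach_ideal.
move=> [T [Z [S0 [U [[H [S [U0 [hH ->]]]] BU ->]]]] TE].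
have BV : ideal_mem B (op_comp U U0).
  have -> : op_comp U U0 = op_comp (op_id _) (op_comp U U0) by exact: operatorP.
  exact: ideal_mem_comp.
have /= := BL _ _ _ BV.
by rewrite (@no_hilbert_linfty_factorization _ _ _ S (op_comp U U0) hH TE) ltxx.
Qed.
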